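(* Let $X$ be a reflexive Banach space with $1$-symmetric basis $(e_n)_n$. The following are equivalent: (1) The space $X$ satisfies the Convex Combination Property (CCP). (2) The normalized sequence $\left(\frac{r_n}{\|r_n\|_{JF_X}}\right)_{n\in\mathbb{N}}$ of Rademacher functions in $JF_X$ contains a subsequence equivalent to the usual basis of $c_0$.
   Context: $X$ is a (infinite-dimensional, real) reflexive Banach space with a $1$-symmetric basis $(e_n)_n$, i.e. $\|\sum_n \epsilon_n a_n e_{\pi(n)}\|_X=\|\sum_n a_n e_n\|_X$ for all finitely supported real $(a_n)$, signs $\epsilon_n$ and permutations $\pi$ of $\mathbb{N}$. $JF_X$ is the completion of $L^1((0,1))$ under the norm $\|f\|_{JF_X}=\sup\{\|\sum_{j=1}^m(\int_{I_j}f\,d\mu)e_j\|_X : I_1,\dots,I_m\subset(0,1)\text{ pairwise disjoint open intervals}\}$, where $\mu$ is Lebesgue measure. $(r_n)_n$ are the Rademacher functions on $[0,1]$ ($r_n$ takes alternately the values $1$ and $-1$ on the successive dyadic intervals $(\frac{k}{2^n},\frac{k+1}{2^n})$, $0\le k<2^n$). CCP: $X$ satisfies the Convex Combination Property if there exist a strictly increasing sequence $(n_k)_k$ of positive integers and $C>0$ such that the following holds: for $(\sigma_k)_k$ a sequence of successive subsets of $\mathbb{N}$ with $\#\sigma_k=2^{n_k}$ and $\lambda_k=\|\sum_{n\in\sigma_k}e_n\|_X^{-1}$, and for every sequence $(I_k)_k$ with $I_k\subset\sigma_k$ and $\sum_k\frac{\#I_k}{\#\sigma_k}\le 1$, we have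 $\|\sum_{k=1}^\infty\lambda_k\sum_{n\in I_k}e_n\|_X\le C$. A sequence is equivalent to the usual basis of $c_0$ if there are constants $c,C'>0$ with $c\max_i|a_i|\le\|\sum_i a_i x_i\|\le C'\max_i|a_i|$ for all finitely supported real $(a_i)$. *)

(* Defs.v *)
From HB Require Import structures.
From mathcomp Require Import all_boot all_order all_algebra finmap.
From mathcomp Require Import all_classical all_reals all_analysis.
Set Implicit Arguments.
Unset Strict Implicit.
Unset Printing Implicit Defensive.
Import Order.TTheory GRing.Theory Num.Theory.
Import numFieldNormedType.Exports.
Local Open Scope classical_set_scope.
Local Open Scope ring_scope.

(* The basis is indexed from 0: (e_0, e_1, ...). *)

Section Reflexivity.
Context {R : realType} (X : normedModType R).

Definition dual : set (X -> R) :=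
  [set f : X -> R | scalar f /\ continuous f].

Definition dual_norm (f : X -> R) : R :=
  sup [set `|f x| | x in [set x : X | `|x| <= 1]].

(* A function on [X -> R] whose restriction to [dual] belongs to X^{**};
   the values outside [dual] are irrelevant. *)
Definition bidual : set ((X -> R) -> R) :=
  [set Phi |
     (forall (a : R) (f g : X -> R), dual f -> dual g ->
        Phi (fun x => a * f x + g x) = a * Phi f + Phi g) /\
     (exists M : R, forall f, dual f -> `|Phi f| <= M * dual_norm f)].

Definition reflexive_space : Prop :=
  forall Phi, bidual Phi -> exists x : X, forall f, dual f -> Phi f = f x.

End Reflexivity.

Section SymmetricBasis.
Context {R : realType} {X : normedModType R}.

Definition schauder_basis (e : nat -> X) : Prop :=
  forall x : X, exists! a : nat -> R,
    series (fun n => a n *: e n) @ \oo --> x.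

Definition one_symmetric_basis (e : nat -> X) : Prop :=
  schauder_basis e /\
  forall (N : nat) (a : nat -> R) (s : nat -> bool) (p : nat -> nat),
    bijective p ->
    `|\sum_(n < N) ((-1) ^+ s n * a n) *: e (p n)| =
    `|\sum_(n < N) a n *: e n|.

Definition ccp (e : nat -> X) : Prop :=
  exists (n_ : nat -> nat) (C : R),
    [/\ {homo n_ : i j / (i < j)%N}, forall k, (0 < n_ k)%N, 0 < C &
      forall sigma : nat -> {fset nat},
        (forall k, #|` sigma k| = (2 ^ n_ k)%N) ->
        (forall k i j, i \in sigma k -> j \in sigma k.+1 -> (i < j)%N) ->
        let lambda k : R := `|\sum_(n <- sigma k) e n|^-1 in
        forall I_ : nat -> {fset nat},
          (forall k, (I_ k `<=` sigma k)%fset) ->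
          (\sum_(0 <= k <oo)
             ((#|` I_ k|%:R / #|` sigma k|%:R : R)%:E) <= 1)%E ->
          let u := series (fun k => lambda k *: \sum_(n <- I_ k) e n) in
          cvgn u /\ `|limn u| <= C].

Definition equivalent_c0 (x : nat -> X) : Prop :=
  exists c C : R, [/\ 0 < c, 0 < C &
    forall (N : nat) (a : nat -> R),
      c * \big[Num.max/0]_(i < N) `|a i| <= `|\sum_(i < N) a i *: x i|
      <= C * \big[Num.max/0]_(i < N) `|a i|].

End SymmetricBasis.

Section JF.
Context {R : realType} {X : normedModType R}.

Definition L1 : set (R -> R) :=
  [set f | lebesgue_measure.-integrable `]0, 1[ (EFin \o f)].

(* For f in L^1(0,1) this set is nonempty and bounded by
   |e_0| * \int |f| when e is 1-symmetric, so its [sup] is genuine. *)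
Definition JF_norm (e : nat -> X) (f : R -> R) : R :=
  sup [set v : R | exists (m : nat) (a b : 'I_m -> R),
    [/\ forall j, [&& 0 <= a j, a j < b j & b j <= 1],
        trivIset [set: 'I_m] (fun j => [set` `]a j, b j[ ]) &
        v = `|\sum_(j < m)
               (\int[lebesgue_measure]_(t in `]a j, b j[) f t) *: e j|]].

(* [is_JF e iota]: the Banach space J, with the canonical map iota of L^1(0,1)
   into it, is the completion of L^1(0,1) for [JF_norm e]; this determines
   (J, iota) up to a unique isometric isomorphism. Linearity and isometry force
   iota to identify functions that agree almost everywhere on (0,1). *)
Definition is_JF (e : nat -> X) (J : completeNormedModType R)
    (iota : (R -> R) -> J) : Prop :=
  [/\ forall (a : R) (f g : R -> R), L1 f -> L1 g ->
        iota (fun t => a * f t + g t) = a *: iota f + iota g,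
      forall f, L1 f -> `|iota f| = JF_norm e f &
      dense (iota @` L1)].

(* On ]k/2^n, (k+1)/2^n[ with 0 <= k < 2^n, the value is (-1)^k. *)
Definition rademacher (n : nat) (t : R) : R :=
  (-1) ^+ Num.truncn (2 ^+ n * t).

End JF.

(* Main.v *)
Require Import Defs.
From HB Require Import structures.
From mathcomp Require Import all_boot all_order all_algebra finmap.
From mathcomp Require Import all_classical all_reals all_analysis.
From mathcomp Require Import measurable_realfun lra zify.
Set Implicit Arguments.
Unset Strict Implicit.
Unset Printing Implicit Defensive.
Import Order.TTheory GRing.Theory Num.Theory.
Import numFieldNormedType.Exports.
Local Open Scope classical_set_scope.
Local Open Scope ring_scope.

(* All norms in X are computed from snorm s = |sum_i s_i e_i| for finite lists s,
   which by 1-symmetry is invariant under permutations and signs, and monotone.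
   Reflexivity excludes c_0 and l^1, so lambda(2^n) = |e_0 + ... + e_(2^n - 1)|
   tends to infinity and lambda(2^n) / 2^n tends to 0, and it makes the basis
   boundedly complete (this gives the convergence of the series in CCP).
   The JF norm of r_n is comparable to lambda(2^n) / 2^n, so along a lacunary
   subsequence the coefficients theta_k = 1 / |r_(n_k)| and
   lam_k = 1 / lambda(2^(n_k)) grow, resp. decay, geometrically.

   Upper c_0 estimate: for f = sum_k a_k theta_k r_(n_k) and an interval of length
   l, only the two scales n_(k-1), n_k around l matter, and the integral of f is
   O(lam_(k-1) 2^(n_(k-1)) l + lam_k). Summed over disjoint intervals, the second
   part is controlled by CCP directly, the first one by CCP after rounding the
   weights 2^(n_(k-1)) l in [0,1] to 0 or 1.
   Lower estimate, and the converse: packing disjoint dyadic intervals of levels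
   n_k into (0,1), the integral of f over one of level n_k is at least
   |a_k| theta_k 2^(-n_k) / 2, since finer Rademacher functions integrate to 0 and
   coarser ones contribute a geometrically small term. *)

(** * Permutations of the indices and convexity of balls *)

(** 1-symmetry speaks of bijections of all of [nat], while the vectors to be compared involve
    finitely many distinct indices. The list is completed by the missing numbers up to its maximum,
    and [p] is the identity beyond. *)
Lemma uniq_extend_bij (s : seq nat) : uniq s ->
  exists p : nat -> nat, bijective p /\ forall i, (i < size s)%N -> p i = nth 0%N s i.
Proof.
move=> us; pose M := (\max_(i <- s) i).+1.
pose t := s ++ [seq j <- iota 0 M | j \notin s].
have tP (j : nat) : (j \in t) = (j < M)%N.
  rewrite mem_cat (mem_filter (fun j => j \notin s) j) mem_iota add0n /=.
  case: (boolP (j \in s)) => //= js; apply/esym.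
  by rewrite ltnS; apply: leq_bigmax_seq.
have ut : uniq t.
  rewrite cat_uniq us filter_uniq ?iota_uniq// andbT.
  by apply/hasPn => j; rewrite mem_filter => /andP[].
have szt : size t = M.
  have /perm_size -> : perm_eq t (iota 0 M); last by rewrite size_iota.
  by apply: uniq_perm => //; [exact: iota_uniq|move=> j; rewrite tP mem_iota add0n].
exists (fun i => nth i t i); split; last first.
  move=> i si; rewrite (set_nth_default 0%N) ?nth_cat ?si// size_cat.
  exact: leq_trans si (leq_addr _ _).
exists (fun j => if (j < M)%N then index j t else j) => i /=.
  have [iM|Mi] := ltnP i (size t).
    by rewrite -tP mem_nth// index_uniq.
  by rewrite nth_default// -szt ltnNge Mi.
case: ifPn => [jM|].
  by rewrite nth_index// tP.
by rewrite -szt -leqNgt => h; rewrite nth_default.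
Qed.

Lemma norm_conv (R : realType) (X : normedModType R) (t c : R) (u v : X) :
  0 <= t <= 1 -> `|u| <= c -> `|v| <= c -> `|t *: u + (1 - t) *: v| <= c.
Proof.
move=> /andP[t0 t1] uc vc; apply: (le_trans (ler_normD _ _)).
rewrite 2!normrZ (ger0_norm t0) ger0_norm ?subr_ge0//.
have -> : c = t * c + (1 - t) * c by lra.
by apply: lerD; rewrite ler_wpM2l// subr_ge0.
Qed.

Lemma perm_cons_cat (T : eqType) (x : T) (s t : seq T) :
  perm_eq (x :: s ++ t) (s ++ x :: t).
Proof. by rewrite -cat1s -(cat1s x t) perm_catCA. Qed.

(** * The norm of finite lists of coefficients *)

Section SymNorm.
Context {R : realType} {X : normedModType R} (e : nat -> X).
Context (e_sym : one_symmetric_basis e).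

(** With lists, reordering is a [perm_eq] and joining disjoint supports a concatenation; by symmetry
    it does not matter which basis vectors carry the coefficients. *)
Definition snorm (s : seq R) : R := `|\sum_(i < size s) s`_i *: e i|.

Lemma norm_sum_uniq (t : seq nat) (a : nat -> R) (b : nat -> bool) : uniq t ->
  `|\sum_(i < size t) ((-1) ^+ b i * a i) *: e (nth 0%N t i)| =
  `|\sum_(i < size t) a i *: e i|.
Proof.
move=> ut; have [p [pb pE]] := uniq_extend_bij ut.
rewrite -(e_sym.2 (size t) a b p pb); congr (`| _ |).
by apply: eq_bigr => i _; rewrite pE.
Qed.

Lemma snorm_reindex (T : Type) (s : seq T) (h : T -> nat) (c : T -> R) :
  uniq (map h s) -> `|\sum_(x <- s) c x *: e (h x)| = snorm (map c s).
Proof.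
case: s => [_|x0 s']; first by rewrite /snorm !big_nil /= big_ord0.
set s := x0 :: s' => us.
rewrite /snorm (big_nth x0) big_mkord size_map.
have := norm_sum_uniq (fun i => c (nth x0 s i)) (fun=> false) us.
rewrite size_map => E.
transitivity `|\sum_(i < size s) c (nth x0 s i) *: e i|.
  rewrite -E; congr (`| _ |); apply: eq_bigr => i _.
  by rewrite expr0 mul1r (nth_map x0).
by congr (`| _ |); apply: eq_bigr => i _; rewrite (nth_map x0).
Qed.

Lemma snorm_perm (s t : seq R) : perm_eq s t -> snorm s = snorm t.
Proof.
move=> st; have [I Ip ->] := perm_iotaP 0 st.
have uI : uniq I by rewrite (perm_uniq Ip) iota_uniq.
rewrite -(snorm_reindex (s := I) (h := id)) ?map_id// (perm_big _ Ip) /=.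
by rewrite /snorm /index_iota -(big_mkord predT (fun i => t`_i *: e i)) /index_iota subn0.
Qed.

Lemma snorm_ge0 s : 0 <= snorm s. Proof. exact: normr_ge0. Qed.

Lemma snorm_rcons0 s : snorm (rcons s 0) = snorm s.
Proof.
rewrite /snorm size_rcons big_ord_recr /= nth_rcons ltnn eqxx scale0r addr0.
by congr (`| _ |); apply: eq_bigr => i _; rewrite nth_rcons ltn_ord.
Qed.

Lemma snorm_cons0 s : snorm (0 :: s) = snorm s.
Proof. by rewrite -(snorm_rcons0 s); apply: snorm_perm; rewrite perm_sym perm_rcons. Qed.

Lemma snorm_nil : snorm [::] = 0.
Proof. by rewrite /snorm big_ord0 normr0. Qed.

Lemma snorm1 x : snorm [:: x] = `|x| * `|e 0%N|.
Proof. by rewrite /snorm big_ord1 normrZ. Qed.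

Lemma snorm_cons x s : snorm (x :: s) = `|x *: e 0%N + \sum_(i < size s) s`_i *: e i.+1|.
Proof. by rewrite /snorm /= big_ord_recl. Qed.

Lemma snorm_oppl x s : snorm (- x :: s) = snorm (x :: s).
Proof.
rewrite /snorm /= -(e_sym.2 (size s).+1 (fun i => (x :: s)`_i) (fun i => i == 0%N) id)//=;
  last by exists id.
congr (`| _ |); apply: eq_bigr => -[[|i] ?] _ //=.
  by rewrite expr1 mulN1r.
by rewrite expr0 mul1r.
Qed.

Lemma snorm_cat s t : snorm (s ++ t) <= snorm s + snorm t.
Proof.
rewrite /snorm size_cat big_split_ord /=; apply: (le_trans (ler_normD _ _)).
apply: lerD.
  rewrite le_eqVlt; apply/orP; left; apply/eqP; congr (`| _ |).
  by apply: eq_bigr => i _; rewrite nth_cat ltn_ord.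
have tE : map (nth 0 t) (iota 0 (size t)) = t := mkseq_nth 0 t.
rewrite -[leRHS]/(snorm t) -[X in _ <= snorm X]tE.
rewrite -(snorm_reindex (h := fun i => (size s + i)%N)); last first.
  by rewrite map_inj_uniq ?iota_uniq//; apply: addnI.
rewrite -(big_mkord predT (fun i => (s ++ t)`_(size s + i) *: e (size s + i)%N)).
rewrite /index_iota subn0.
rewrite le_eqVlt; apply/orP; left; apply/eqP; congr (`| _ |).
by apply: eq_bigr => i _; rewrite nth_cat ltnNge leq_addr /= addKn.
Qed.

Lemma snorm_scale a s : snorm (map ( *%R a) s) = `|a| * snorm s.
Proof.
rewrite /snorm size_map -normrZ scaler_sumr; congr (`| _ |).
by apply: eq_bigr => i _; rewrite (nth_map 0)// scalerA.
Qed.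

(** A scalar between [- y] and [y] is a convex combination of the two, and replacing the first
    coefficient [y] by [- y] preserves the norm. *)
Lemma snorm_cons_mono x y s : `|x| <= `|y| -> snorm (x :: s) <= snorm (y :: s).
Proof.
wlog y0 : y / 0 <= y => [H|].
  by have [/H//|y0 xy] := leP 0 y; rewrite -(snorm_oppl y) H ?normrN// oppr_ge0 ltW.
rewrite (ger0_norm y0) ler_norml => /andP[xy1 xy2].
have [y00|yn0] := eqVneq y 0.
  by have -> : x = y by lra.
pose t := (x + y) / (2 * y).
have yp : 0 < y by rewrite lt_def yn0.
have t0 : 0 <= t by rewrite divr_ge0//; lra.
have t1 : t <= 1 by rewrite ler_pdivrMr; lra.
have tE : t * (2 * y) = x + y by rewrite divfK// gt_eqF//; lra.
have xE : x = t * y + (1 - t) * - y by lra.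
rewrite snorm_cons; set v := \sum_(i < _) _.
have -> : x *: e 0%N + v = t *: (y *: e 0%N + v) + (1 - t) *: (- y *: e 0%N + v).
  rewrite {1}xE !scalerDr !scalerA addrACA -!scalerDl; congr (_ + _).
  by rewrite addrC subrK scale1r.
apply: norm_conv; first exact/andP.
  by rewrite -snorm_cons.
by rewrite -snorm_cons snorm_oppl.
Qed.

Lemma snorm_mono (T : eqType) (s : seq T) (c d : T -> R) :
  {in s, forall x, `|c x| <= `|d x|} -> snorm (map c s) <= snorm (map d s).
Proof.
suff H u : {in s, forall x, `|c x| <= `|d x|} ->
  snorm (u ++ map c s) <= snorm (u ++ map d s) by exact: (H [::]).
elim: s u => [//|x s IH] u cd /=.
apply: (@le_trans _ _ (snorm (d x :: (u ++ map c s)))).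
  rewrite (@snorm_perm _ (c x :: (u ++ map c s))) ?snorm_cons_mono//.
    by rewrite cd// mem_head.
  by rewrite -cat1s perm_catCA.
rewrite -cat_cons [leRHS](@snorm_perm _ ((d x :: u) ++ map d s)).
  by apply: IH => y ys; rewrite cd// inE ys orbT.
by rewrite cat_cons -(cat1s (d x)) perm_catCA.
Qed.

Lemma snorm_cat0 s n : snorm (s ++ nseq n 0) = snorm s.
Proof.
elim: n s => [|n IH] s /=; first by rewrite cats0.
by rewrite -cat_rcons IH snorm_rcons0.
Qed.

Lemma snorm_catl s t : snorm s <= snorm (s ++ t).
Proof.
elim: t s => [|x t IH] s; first by rewrite cats0.
rewrite -cat_rcons -snorm_cons0; apply: le_trans (IH _).
rewrite [leRHS](@snorm_perm _ (x :: s)) ?perm_rcons//.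
by apply: snorm_cons_mono; rewrite normr0.
Qed.

(** The pair [(x, y)] is a convex combination of [(a, b)] and [(b, a)], and swapping two
    coefficients preserves the norm. Hence spreading a pair apart at constant sum does not decrease
    the norm. *)
Lemma snorm_exchange x y a b t s : 0 <= t <= 1 ->
  x = t * a + (1 - t) * b -> y = (1 - t) * a + t * b ->
  snorm (x :: y :: s) <= snorm (a :: b :: s).
Proof.
move=> t01 -> ->.
have sw : snorm (b :: a :: s) = snorm (a :: b :: s).
  by apply: snorm_perm; rewrite -cat1s -(cat1s a) perm_catCA.
have E z w : snorm (z :: w :: s) =
    `|z *: e 0%N + w *: e 1%N + \sum_(i < size s) s`_i *: e i.+2|.
  by rewrite /snorm /= !big_ord_recl /= addrA.
rewrite E; set v := \sum_(i < _) _.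
set Y := (X in `|X|).
have -> : Y = t *: (a *: e 0%N + b *: e 1%N + v) + (1 - t) *: (b *: e 0%N + a *: e 1%N + v).
  rewrite /Y 2!scalerDr [X in _ = _ + X]scalerDr addrACA -scalerDl addrC subrKC scale1r.
  rewrite [in RHS]addrC; congr (_ + _); rewrite !scalerDr !scalerA addrACA -!scalerDl.
  by congr (_ *: _ + _ *: _); rewrite addrC.
by apply: norm_conv => //; rewrite -E// sw.
Qed.

(** Exchange towards the pair [(k * (x + y), 0)]. *)
Lemma snorm_merge k x y s : 0 <= x -> 0 <= y ->
  snorm (k * x :: k * y :: s) <= snorm (k * (x + y) :: s).
Proof.
move=> x0 y0; have [z|n0] := eqVneq (x + y) 0.
  have -> : x = 0 by lra.
  have -> : y = 0 by lra.
  by rewrite addr0 mulr0 snorm_cons0.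
have xy : 0 < x + y by lra.
rewrite -[leRHS]snorm_cons0 [leRHS](@snorm_perm _ (k * (x + y) :: 0 :: s)); last first.
  by rewrite -cat1s -(cat1s (k * _)) perm_catCA.
pose t := x / (x + y).
have tE : t * (x + y) = x by rewrite divfK.
have tkE : k * x = t * (k * (x + y)) by rewrite mulrCA tE.
apply: (@snorm_exchange _ _ _ _ t).
- by rewrite divr_ge0 ?addr_ge0//= ler_pdivrMr//; lra.
- lra.
- lra.
Qed.

(** Exchange towards the most spread pair of weights in [0,1] with the same sum. *)
Lemma snorm_exchange1 k x y s : 0 <= x <= 1 -> 0 <= y <= 1 -> 1 < x + y ->
  snorm (k * x :: k * y :: s) <= snorm (k :: k * (x + y - 1) :: s).
Proof.
move=> /andP[x0 x1] /andP[y0 y1] xy.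
have [z|n0] := eqVneq (x + y) 2.
  have -> : x = 1 by lra.
  have -> : y = 1 by lra.
  by rewrite addrK mulr1.
have xy2 : 0 < 2 - (x + y) by lra.
(* The solution of [x = t + (1 - t) * (x + y - 1)]. *)
pose t := (1 - y) / (2 - (x + y)).
have tE : t * (2 - (x + y)) = 1 - y by rewrite divfK// gt_eqF.
have tkE : t * (k * (2 - (x + y))) = k * (1 - y) by rewrite mulrCA tE.
apply: (@snorm_exchange _ _ _ _ t).
- rewrite divr_ge0 ?ler_pdivrMr//=; lra.
- lra.
- lra.
Qed.

(* Rounding: within each label, fractional weights are pushed to 0 or 1 (which
   only increases the norm) until at most one fractional weight per label is left. *)
Lemma snorm_rounding (lam : nat -> R) (s : seq (nat * R)) :
  {in s, forall p, 0 <= p.2 <= 1} ->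
  exists (s1 : seq nat) (s2 : seq (nat * R)),
    [/\ uniq (map fst s2),
        {subset map fst s2 <= map fst s},
        {in s2, forall p, 0 <= p.2 <= 1},
        forall g : nat -> R, \sum_(k <- s1) g k + \sum_(p <- s2) g p.1 * p.2 =
           \sum_(p <- s) g p.1 * p.2 &
        forall u, snorm (u ++ [seq lam p.1 * p.2 | p <- s]) <=
          snorm (u ++ map lam s1 ++ [seq lam p.1 * p.2 | p <- s2])].
Proof.
elim: s => [_|[k w] s IH H].
  by exists [::], [::]; split=> // g; rewrite !big_nil addr0.
have /IH[s1 [s2 [us2 ss2 ws2 gE le2]]] : {in s, forall p, 0 <= p.2 <= 1}.
  by move=> p ps; rewrite H// inE ps orbT.
have /andP[w0 w1] : 0 <= w <= 1 by rewrite (H (k, w))// mem_head.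
have step u : snorm (u ++ [seq lam p.1 * p.2 | p <- (k, w) :: s]) <=
    snorm (lam k * w :: (u ++ map lam s1 ++ [seq lam p.1 * p.2 | p <- s2])).
  rewrite /= -cat_rcons; apply: (le_trans (le2 _)); rewrite le_eqVlt; apply/orP; left.
  apply/eqP; apply: snorm_perm; rewrite cat_rcons.
  by rewrite -cat1s perm_catCA.
(* A label without a leftover weight so far takes [w] as its leftover. *)
have [kin|knotin] := boolP (k \in map fst s2); last first.
  exists s1, ((k, w) :: s2); split.
  - by rewrite /= knotin.
  - by move=> x; rewrite !inE => /predU1P[->|/ss2 ->]; rewrite ?eqxx ?orbT.
  - by move=> p; rewrite inE => /predU1P[->|/ws2]//=; rewrite w0.
  - by move=> g; rewrite !big_cons /= addrCA gE.
  - move=> u; apply: (le_trans (step u)); rewrite le_eqVlt; apply/orP; left.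
    by apply/eqP; apply: snorm_perm; rewrite /= !catA perm_cons_cat.
have /mapP[[k' w'] kin' /= kE] := kin; rewrite -{}kE in kin'.
have ps2 := perm_to_rem kin'; set s2' := rem (k, w') s2 in ps2.
have us2' : uniq (k :: map fst s2').
  by rewrite -(perm_uniq (perm_map fst ps2)).
have /andP[w'0 w'1] : 0 <= w' <= 1 by rewrite (ws2 (k, w')).
have ws2' p : p \in s2' -> 0 <= p.2 <= 1 by move=> /mem_rem/ws2.
have ss2' x : x \in k :: map fst s2' -> x \in k :: map fst s.
  rewrite !inE => /predU1P[->|xs]; rewrite ?eqxx//; apply/orP; right; apply: ss2.
  by rewrite (perm_mem (perm_map fst ps2)) inE xs orbT.
have gE' (g : nat -> R) : \sum_(k <- s1) g k + \sum_(p <- s2') g p.1 * p.2 + g k * w' =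
           \sum_(p <- s) g p.1 * p.2.
  by rewrite -gE (perm_big _ ps2) big_cons /= -addrA; congr (_ + _); rewrite addrC.
have step' u : snorm (u ++ [seq lam p.1 * p.2 | p <- (k, w) :: s]) <=
    snorm (lam k * w :: lam k * w' :: (u ++ map lam s1 ++ [seq lam p.1 * p.2 | p <- s2'])).
  apply: (le_trans (step u)); rewrite le_eqVlt; apply/orP; left.
  apply/eqP; apply: snorm_perm; rewrite perm_cons.
  rewrite catA (permPl (perm_cat (perm_refl _) (perm_map _ ps2)))/=.
  by rewrite catA -(cat1s (lam k * w')) perm_catCA.
(* Two fractional weights with the same label: if their sum is at most 1 they are merged; otherwise
   one is raised to 1 and its label moves to the list [s1], and the excess stays as leftover. *)
have [le1|gt1] := leP (w + w') 1.
  exists s1, ((k, w + w') :: s2'); split=> //.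
  - by move=> p; rewrite inE => /predU1P[->|/ws2']//=; rewrite addr_ge0.
  - by move=> g; rewrite !big_cons -gE' /=; lra.
  - move=> u; apply: (le_trans (step' u)); apply: (le_trans (snorm_merge _ _ w0 w'0)).
    rewrite le_eqVlt; apply/orP; left; apply/eqP; apply: snorm_perm.
    by rewrite /= !catA perm_cons_cat.
exists (k :: s1), ((k, w + w' - 1) :: s2'); split=> //.
- by move=> p; rewrite inE => /predU1P[->|/ws2']//=; lra.
- by move=> g; rewrite !big_cons -gE' /=; lra.
- move=> u; apply: (le_trans (step' u)).
  apply: (le_trans (@snorm_exchange1 _ _ _ _ _ _ gt1)); [exact/andP|exact/andP|].
  rewrite le_eqVlt; apply/orP; left; apply/eqP; apply: snorm_perm.
  rewrite /= -(permPr (perm_cons_cat _ _ _)) perm_cons.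
  by rewrite !catA perm_cons_cat.
Qed.

(** The fundamental function of the basis. *)
Definition lambda_ m : R := snorm (nseq m 1).

Lemma lambda_ge0 m : 0 <= lambda_ m. Proof. exact: snorm_ge0. Qed.

Lemma lambda_mono m n : (m <= n)%N -> lambda_ m <= lambda_ n.
Proof. by move=> /subnKC <-; rewrite /lambda_ nseqD snorm_catl. Qed.

Lemma lambdaD m n : lambda_ (m + n) <= lambda_ m + lambda_ n.
Proof. by rewrite /lambda_ nseqD snorm_cat. Qed.

Lemma lambda1 : lambda_ 1 = `|e 0%N|.
Proof. by rewrite /lambda_ snorm1 normr1 mul1r. Qed.

Lemma snorm_nseq m (a : R) : snorm (nseq m a) = `|a| * lambda_ m.
Proof. by rewrite -snorm_scale map_nseq mulr1. Qed.

(** Averaging all rotations of [s] replaces every coefficient by the mean, while each rotation has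
    the norm of [s]. *)
Lemma snorm_average s : (\sum_(x <- s) x) * lambda_ (size s) <= (size s)%:R * snorm s.
Proof.
set m := size s; set S := \sum_(x <- s) x.
have rotE r i : (r < m)%N -> (i < m)%N -> (rot r s)`_i = (rot i s)`_r.
  move=> rm im; rewrite /rot !nth_cat !size_drop -/m.
  case: ifPn => h1; case: ifPn => h2; try lia.
  - by rewrite !nth_drop addnC.
  - by rewrite !nth_take; [congr nth; lia|lia|lia].
apply: (@le_trans _ _ `|\sum_(r < m) \sum_(i < m) (rot r s)`_i *: e i|).
  rewrite exchange_big /=.
  have -> : \sum_(i < m) \sum_(r < m) (rot r s)`_i *: e i = \sum_(i < m) S *: e i.
    apply: eq_bigr => i _; rewrite -scaler_suml; congr (_ *: _).
    rewrite /S -[RHS](perm_big _ (permEl (perm_rot i s)))/= [RHS](big_nth 0) size_rot big_mkord.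
    by apply: eq_bigr => r _; rewrite rotE.
  rewrite (_ : `|_| = snorm (nseq m S)) ?snorm_nseq; last first.
    rewrite -snorm_nseq /snorm size_nseq; congr (`| _ |); apply: eq_bigr => i _.
    by rewrite nth_nseq ltn_ord.
  by rewrite ler_wpM2r ?lambda_ge0// ler_norm.
apply: (le_trans (ler_norm_sum _ _ _)).
rewrite (eq_bigr (fun=> snorm s)).
  by rewrite sumr_const card_ord mulr_natl.
move=> r _; rewrite -[RHS](@snorm_perm (rot r s)) ?perm_rot//.
by rewrite /snorm size_rot.
Qed.

End SymNorm.

(** * Consequences of reflexivity *)

Section Reflexive.
Context {R : realType} (X : normedModType R).

Lemma dual_bounded (f : X -> R) : dual f -> exists M, forall x, `|f x| <= M * `|x|.
Proof.
move=> [flin fcont].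
have f0 : f 0 = 0 by have := flin (-1) 0 0; rewrite scaler0 addr0; lra.
have fZ a x : f (a *: x) = a * f x by have := flin a x 0; rewrite addr0 f0 addr0.
have /cvgrPdist_lt/(_ 1 ltr01)/nbhs_normP[d /= d0 dP] := fcont 0.
exists (2 / d) => x; have [->|x0] := eqVneq x 0; first by rewrite f0 !normr0 mulr0.
have nx : 0 < `|x| by rewrite normr_gt0.
pose c := d / 2 / `|x|.
have c0 : 0 < c by rewrite !divr_gt0.
have cx : c * `|x| = d / 2 by rewrite divfK ?gt_eqF.
have : `|f 0 - f (c *: x)| < 1.
  by apply: dP; rewrite /ball_ /= sub0r normrN normrZ gtr0_norm// cx; lra.
rewrite f0 sub0r normrN fZ normrM gtr0_norm// => /ltW h.
rewrite -(ler_pM2l c0) (le_trans h)// mulrCA cx.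
by rewrite -invf_div mulVf// gt_eqF// divr_gt0.
Qed.

Lemma le_dual_norm (f : X -> R) x : dual f -> `|f x| <= `|x| * dual_norm f.
Proof.
move=> df; have [M fM] := dual_bounded df; have [flin _] := df.
have f0 : f 0 = 0 by have := flin (-1) 0 0; rewrite scaler0 addr0; lra.
have fZ a y : f (a *: y) = a * f y by have := flin a y 0; rewrite addr0 f0 addr0.
have [->|x0] := eqVneq x 0; first by rewrite f0 !normr0 mul0r.
have nx : 0 < `|x| by rewrite normr_gt0.
have : `|f (`|x|^-1 *: x)| <= dual_norm f.
  apply: ub_le_sup.
    exists `|M| => _ [y /= y1 <-]; apply: (le_trans (fM y)).
    apply: (@le_trans _ _ (`|M| * `|y|)); first by rewrite ler_wpM2r// ler_norm.
    by rewrite -[leRHS]mulr1 ler_wpM2l.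
  by exists (`|x|^-1 *: x) => //=; rewrite normrZ normfV normr_id mulVf// gt_eqF.
by rewrite fZ normrM normfV normr_id -(ler_pM2l nx) mulrA mulfV ?mul1r// gt_eqF.
Qed.

Lemma dual_norm_ge0 (f : X -> R) : dual f -> 0 <= dual_norm f.
Proof.
move=> df; have [M fM] := dual_bounded df; have [flin _] := df.
have f0 : f 0 = 0 by have := flin (-1) 0 0; rewrite scaler0 addr0; lra.
apply: ub_le_sup; last by exists 0; rewrite /= ?normr0// f0 normr0.
exists `|M| => _ [y /= y1 <-]; apply: (le_trans (fM y)).
apply: (@le_trans _ _ (`|M| * `|y|)); first by rewrite ler_wpM2r// ler_norm.
by rewrite -[leRHS]mulr1 ler_wpM2l.
Qed.

(* The functional represented by x is the limit of evaluation at (u n) along a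
   free ultrafilter. *)
Lemma reflexive_weak_limit (u : nat -> X) (M : R) :
  reflexive_space X -> (forall n, `|u n| <= M) ->
  exists x, forall f, dual f -> forall l, f (u n) @[n --> \oo] --> l -> f x = l.
Proof.
move=> refl uM.
have [U [UU ooU]] := @ultraFilterLemma nat \oo _.
have ucv f : dual f -> exists2 l : R, f (u n) @[n --> U] --> l & `|l| <= M * dual_norm f.
  move=> df; pose B := M * dual_norm f.
  have fB n : `|f (u n)| <= B.
    apply: (le_trans (le_dual_norm (u n) df)).
    by rewrite ler_wpM2r// dual_norm_ge0.
  have cB : compact `[- B, B]%classic by exact: segment_compact.
  (* The image of an ultrafilter is an ultrafilter; living on a compact segment, it converges. *)
  have FU : UltraFilter (f (u n) @[n --> U]).
    split; first exact: fmap_proper_filter.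
    move=> G GG sG; apply/seteqP; split=> // A GA.
    have [//|nA] := in_ultra_setVsetC ((f \o u) @^-1` A) UU.
    have GnA : G (~` A) by apply: sG.
    have G0 : G set0 by rewrite -(setICr A); exact: filterI.
    by have [] := filter_ex G0.
  move: cB; rewrite compact_ultra => /(_ _ FU)[].
    by apply: (@filterS _ U _ setT) => [n _ /=|]; [rewrite in_itv /= -ler_norml|exact: filterT].
  move=> l [/= lB Ul]; exists l => //.
  by rewrite in_itv /= in lB; rewrite ler_norml.
pose Phi (f : X -> R) : R := lim (f (u n) @[n --> U]).
have PhiE (f : X -> R) (l : R) : f (u n) @[n --> U] --> l -> Phi f = l.
  by move=> /cvg_lim; apply.
have [|x xP] := refl Phi.
  split.
    move=> a f g df dg; have [lf fl _] := ucv _ df; have [lg gl _] := ucv _ dg.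
    rewrite (PhiE _ _ fl) (PhiE _ _ gl); apply: PhiE.
    by apply: cvgD => //; apply: cvgM => //; exact: cvg_cst.
  by exists M => f df; have [lf fl Bf] := ucv _ df; rewrite (PhiE _ _ fl).
exists x => f df l fl; rewrite -xP//; apply: PhiE.
by move=> A /fl; exact: ooU.
Qed.

End Reflexive.

Lemma dual_of_bound (R : realType) (X : normedModType R) (f : X -> R) (M : R) :
  (forall a x y, f (a *: x + y) = a * f x + f y) ->
  (forall x, `|f x| <= M * `|x|) -> dual f.
Proof.
move=> fl fM; split=> // x; apply/cvgrPdist_lt => /= eps eps0.
have M1 : 0 < `|M| + 1 by rewrite ltr_wpDl.
apply/nbhs_normP; exists (eps / (`|M| + 1)) => /=; first by rewrite divr_gt0.
move=> y /= xy.
have -> : f x - f y = f (- 1 *: y + x) by rewrite fl; lra.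
rewrite scaleN1r addrC (le_lt_trans (fM _))//.
apply: (@le_lt_trans _ _ ((`|M| + 1) * `|x - y|)).
  by rewrite ler_wpM2r// (le_trans (ler_norm _))// lerDl.
by rewrite mulrC -ltr_pdivlMr.
Qed.

(** * Coefficient functionals, bounded completeness and growth of the fundamental function *)

Section Basis.
Context {R : realType} {X : normedModType R} (e : nat -> X).
Context (e_sym : one_symmetric_basis e).

Let psum (a : nat -> R) (n : nat) : X := series (fun k => a k *: e k) n.

Lemma psumE a n : psum a n = \sum_(i < n) a i *: e i.
Proof. by rewrite /psum /series /= big_mkord. Qed.

Lemma norm_psum a n : `|psum a n| = snorm e (map a (iota 0 n)).
Proof.
rewrite psumE /snorm size_map size_iota; congr (`| _ |); apply: eq_bigr => i _.
by rewrite (nth_map 0%N) ?size_iota// nth_iota.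
Qed.

(** For fixed [n], [coef ^~ n] is the n-th biorthogonal functional; its linearity comes from the
    uniqueness of expansions. *)
Definition coef (x : X) : nat -> R := projT1 (cid (e_sym.1 x)).

Lemma coefP x : psum (coef x) @ \oo --> x.
Proof. by rewrite /coef; case: cid => a []. Qed.

Lemma coef_unique x a : psum a @ \oo --> x -> a = coef x.
Proof. by move=> ax; rewrite /coef; case: cid => b /= [_ ub]; rewrite (ub _ ax). Qed.

Lemma coef_lin a x y : coef (a *: x + y) = (fun n => a * coef x n + coef y n).
Proof.
apply/esym/coef_unique.
rewrite (_ : psum _ = fun n => a *: psum (coef x) n + psum (coef y) n).
  by apply: cvgD; [apply: cvgZr; exact: coefP|exact: coefP].
apply/funext => n; rewrite !psumE scaler_sumr -big_split /=; apply: eq_bigr => i _.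
by rewrite scalerDl scalerA.
Qed.

Lemma coef_psum a m : coef (psum a m) = fun n => if (n < m)%N then a n else 0.
Proof.
apply/esym/coef_unique; rewrite -(cvg_shiftn m) /=.
rewrite (_ : (fun _ => _) = fun=> psum a m); first exact: cvg_cst.
apply/funext => n; rewrite !psumE addnC big_split_ord /= [X in _ + X]big1 ?addr0.
  by apply: eq_bigr => i _; rewrite ltn_ord.
by move=> i _; rewrite ltnNge leq_addr scale0r.
Qed.

Lemma norm_psum_mono a m n : (m <= n)%N -> `|psum a m| <= `|psum a n|.
Proof. by move=> /subnKC <-; rewrite !norm_psum iotaD map_cat snorm_catl. Qed.

Lemma norm_psum_le x m : `|psum (coef x) m| <= `|x|.
Proof.
have cx : `|psum (coef x) n| @[n --> \oo] --> `|x| by apply: cvg_norm; exact: coefP.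
rewrite -(cvg_lim _ cx)//; apply: limr_ge; first by apply/cvg_ex; exists `|x|.
by near=> n; apply: norm_psum_mono; near: n; exists m.
Unshelve. all: by end_near. Qed.

Lemma snorm_nth (s : seq R) i : (i < size s)%N -> `|s`_i| * `|e 0%N| <= snorm e s.
Proof.
move=> si; rewrite -snorm1 (snorm_perm e_sym (perm_to_rem (mem_nth 0 si))).
by rewrite -cat1s snorm_catl.
Qed.

Lemma coef_le x n : `|coef x n| * `|e 0%N| <= `|x|.
Proof.
apply: le_trans (norm_psum_le x n.+1); rewrite norm_psum.
have := @snorm_nth (map (coef x) (iota 0 n.+1)) n.
by rewrite size_map size_iota (nth_map 0%N) ?size_iota// nth_iota//; apply.
Qed.

Lemma norm_basis n : `|e n| = `|e 0%N|.
Proof.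
have := @snorm_reindex _ _ e e_sym _ [:: tt] (fun=> n) (fun=> 1) isT.
by rewrite big_seq1 scale1r /= snorm1 normr1 mul1r.
Qed.

(** All [e n] have the same norm; if it were 0, every sequence of coefficients would represent 0,
    against uniqueness of expansions. *)
Lemma norm_basis_gt0 : 0 < `|e 0%N|.
Proof.
rewrite normr_gt0; apply/eqP => e0.
have en n : e n = 0 by apply/eqP; rewrite -normr_eq0 norm_basis e0 normr0.
have H a : a = coef 0.
  apply: coef_unique; rewrite (_ : psum a = fun=> 0); first exact: cvg_cst.
  by apply/funext => n; rewrite psumE big1// => i _; rewrite en scaler0.
have /(congr1 (@^~ 0%N))/eqP : (fun _ : nat => 0 : R) = (fun=> 1).
  by rewrite [LHS]H [RHS]H.
by rewrite eq_sym oner_eq0.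
Qed.

Lemma dual_coef n : dual (coef ^~ n).
Proof.
apply: (@dual_of_bound _ _ _ (`|e 0%N|^-1)).
  by move=> a x y; rewrite coef_lin.
by move=> x; rewrite mulrC ler_pdivlMr ?norm_basis_gt0// coef_le.
Qed.

Lemma coef_basis n k : coef (e n) k = (k == n)%:R.
Proof.
have <- : psum (fun k => (k == n)%:R) n.+1 = e n.
  rewrite psumE big_ord_recr /= eqxx scale1r big1 ?add0r// => i _.
  by rewrite ltn_eqF ?scale0r.
rewrite coef_psum; case: ifPn => //; rewrite -leqNgt => nk.
by rewrite gtn_eqF.
Qed.

Lemma coef_inj0 x : coef x = (fun=> 0) -> x = 0.
Proof.
move=> x0; have := coefP (x := x); rewrite x0.
rewrite (_ : psum _ = fun=> 0); last first.
  by apply/funext => n; rewrite psumE big1// => i _; rewrite scale0r.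
by move=> /cvg_lim <-//; rewrite lim_cst.
Qed.

Context (refl : reflexive_space X).

(** The bounded partial sums have a weak limit point [x]; testing it against the biorthogonal
    functionals identifies the coefficients of [x] with [a]. *)
Lemma boundedly_complete a M :
  (forall n, `|psum a n| <= M) -> cvgn (series (fun k => a k *: e k)).
Proof.
move=> aM; have [x xP] := reflexive_weak_limit refl aM.
apply/cvg_ex; exists x => /=; rewrite (_ : a = coef x); first exact: coefP.
apply/funext => k; apply/esym.
apply: (xP (coef ^~ k)); first exact: dual_coef.
rewrite -(cvg_shiftn k.+1) /=.
rewrite (_ : (fun _ => _) = fun=> a k); first exact: cvg_cst.
by apply/funext => n; rewrite -/(psum _ _) coef_psum addnS ltnS leq_addl.
Qed.

(** Were the fundamental function bounded, as in c_0, the series of the [e n] would converge by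
    bounded completeness, although its terms have constant positive norm. *)
Lemma lambda_unbounded B : exists m, B < lambda_ e m.
Proof.
apply/not_existsP => H.
have /cvg_series_cvg_0 : cvgn (series (fun k => (fun=> 1 : R) k *: e k)).
  apply: (@boundedly_complete (fun=> 1) B) => n; rewrite norm_psum.
  rewrite (_ : map _ _ = nseq n 1); last by elim: n (0%N) => //= n IH m; rewrite IH.
  by rewrite leNgt; apply/negP/H.
move=> /cvg_norm; rewrite normr0.
rewrite (_ : (fun _ => _) = fun=> `|e 0%N|); last first.
  by apply/funext => n; rewrite scale1r norm_basis.
move=> /cvg_lim; rewrite lim_cst// => /(_ (@Rhausdorff R)) e0.
by have := norm_basis_gt0; rewrite e0 ltxx.
Qed.

(** Otherwise averaging shows that the basis dominates that of l^1, so summing the coefficients is a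
    bounded functional. It is 1 at every [e n], yet the only possible weak limit of the [e n] is
    0. *)
Lemma lambda_sublinear eps : 0 < eps -> exists n, lambda_ e (2 ^ n) < eps * 2 ^+ n.
Proof.
move=> eps0; apply/not_existsP => H0.
have H n : eps * 2 ^+ n <= lambda_ e (2 ^ n) by rewrite leNgt; apply/negP.
have l1 s : eps * \sum_(x <- s) `|x| <= snorm e s.
  set m := size s.
  have mlt : (m <= 2 ^ m)%N by rewrite ltnW// ltn_expl.
  (* The assumed lower bound concerns lengths that are powers of two, hence the padding by zeros. *)
  pose t := map Num.norm s ++ nseq (2 ^ m - m) 0.
  have st : size t = (2 ^ m)%N by rewrite size_cat size_map size_nseq subnKC.
  have := @snorm_average _ _ e e_sym t.
  rewrite st big_cat /= [X in _ + X]big1_seq ?addr0; last first.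
    by move=> x /andP[_ /nseqP[]].
  rewrite big_map snorm_cat0 natrX => h.
  rewrite -[leRHS](_ : snorm e (map Num.norm s) = _); last first.
    rewrite -[in RHS](map_id s); apply/eqP; rewrite eq_le.
    by apply/andP; split; apply: snorm_mono => // x _; rewrite normr_id.
  rewrite -(ler_pM2l (exprn_gt0 m (ltr0n _ 2))) (le_trans _ h)//.
  rewrite mulrA [leRHS]mulrC ler_wpM2r ?sumr_ge0//.
  by rewrite mulrC; exact: H.
have abs_le x n : \sum_(i < n) `|coef x i| <= eps^-1 * `|x|.
  rewrite mulrC ler_pdivlMr// mulrC (le_trans _ (norm_psum_le x n))//.
  rewrite norm_psum (le_trans _ (l1 _))// big_map.
  by rewrite -(big_mkord predT (fun i => `|coef x i|)) /index_iota subn0.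
have scv x : cvgn (series (coef x)).
  apply: normed_cvg; apply: nondecreasing_is_cvgn.
    by apply: nondecreasing_series => n _ _; exact: normr_ge0.
  exists (eps^-1 * `|x|) => _ [n _ <-].
  by rewrite /= /series /= big_mkord.
pose S x := limn (series (coef x)).
have dS : dual S.
  apply: (@dual_of_bound _ _ _ eps^-1).
    move=> a x y; rewrite /S coef_lin.
    apply/cvg_lim => //.
    rewrite (_ : series _ = fun n => a * series (coef x) n + series (coef y) n).
      by apply: cvgD; [apply: cvgMr; exact: scv|exact: scv].
    by apply/funext => n; rewrite /series /= mulr_sumr -big_split.
  move=> x; rewrite -lim_norm//; apply: limr_le.
    by apply: is_cvg_norm; exact: scv.
  apply: nearW => n; rewrite /series /= big_mkord.
  by rewrite (le_trans (ler_norm_sum _ _ _)).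
have eB n : `|e n| <= `|e 0%N| by rewrite norm_basis.
have [x xP] := reflexive_weak_limit refl eB.
(* Each coefficient of [e n] is eventually 0, so the weak limit has no nonzero coefficient. *)
have x0 : x = 0.
  apply: coef_inj0; apply/funext => k; apply: (xP (coef ^~ k)); first exact: dual_coef.
  rewrite -(cvg_shiftn k.+1) /=.
  rewrite (_ : (fun _ => _) = fun=> 0); first exact: cvg_cst.
  by apply/funext => n; rewrite coef_basis ltn_eqF// addnS ltnS leq_addl.
have : S x = 1.
  apply: xP => //; rewrite (_ : (fun _ => _) = fun=> 1); first exact: cvg_cst.
  apply/funext => n; 
  suff h : series (coef (e n)) @ \oo --> (1 : R) by apply/cvg_lim.
  rewrite -(cvg_shiftn n.+1).
  rewrite (_ : (fun m => series (coef (e n)) (m + n.+1)%N) = fun=> 1); first exact: cvg_cst.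
  apply/funext => m; rewrite /series /= addnC big_mkord big_split_ord /=.
  rewrite [X in _ + X]big1 ?addr0; last first.
    by move=> i _; rewrite coef_basis gtn_eqF// ltnS leq_addr.
  rewrite big_ord_recr /= big1 ?add0r ?coef_basis ?eqxx// => i _.
  by rewrite coef_basis ltn_eqF.
have [Sl _] := dS; have := Sl (-1) 0 0.
by rewrite scaler0 addr0 x0; lra.
Qed.

End Basis.

(** * Integrals of Rademacher sums over intervals *)

Section StepIntegrals.
Context {R : realType}.
Implicit Types (f : R -> R) (a b : R).
Local Notation mu := (@lebesgue_measure R).

Definition oint f a b : R := \int[mu]_(t in `]a, b[) f t.

(** A class stable under linear combinations, containing the Rademacher functions, whose members are
    integrable on every bounded interval. *)
Definition bddmeas f := measurable_fun setT f /\ exists M, forall t, `|f t| <= M.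

Lemma mu_oo a b : a <= b -> mu `]a, b[ = (b - a)%:E.
Proof.
rewrite lebesgue_measure_itv /= lte_fin le_eqVlt => /predU1P[->|->] //.
by rewrite ltxx subrr.
Qed.

Lemma bddmeas_integrable f (i : interval R) : bddmeas f -> (mu [set` i] < +oo)%E ->
  mu.-integrable [set` i] (EFin \o f).
Proof.
move=> [mf [M fM]] fin; apply: measurable_bounded_integrable => //.
  exact: measurable_funS mf.
exists M; split; first exact: num_real.
by move=> x Mx y _ /=; rewrite (le_trans _ (ltW Mx)).
Qed.

Lemma bddmeas_integrable_oo f a b : bddmeas f -> mu.-integrable `]a, b[ (EFin \o f).
Proof.
move=> bf; apply: bddmeas_integrable => //; rewrite lebesgue_measure_itv /=.
by case: ifPn => // _; rewrite -EFinB ltry.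
Qed.

Lemma bddmeas_L1 f : bddmeas f -> L1 f.
Proof. by move=> bf; exact: bddmeas_integrable_oo. Qed.

Lemma oint_split f a b (c : R) : bddmeas f -> a <= c -> c <= b ->
  oint f a b = oint f a c + oint f c b.
Proof.
move=> bf ac; rewrite le_eqVlt => /predU1P[<-|cb].
  by rewrite [X in _ + X]/oint set_itv_ge ?bnd_simp ?ltxx// Rintegral_set0 addr0.
rewrite /oint -(@Rintegral_itvB _ f (BRight a) (BLeft b) c) ?bnd_simp//; last first.
  exact: bddmeas_integrable_oo.
rewrite -(Rintegral_itv_bndo_bndc (a := BRight a)); last exact: bddmeas_integrable_oo.
by rewrite addrC subrK.
Qed.

Lemma oint_cst f a b k : a <= b -> (forall t, a < t < b -> f t = k) ->
  oint f a b = k * (b - a).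
Proof.
move=> ab fk; rewrite /oint (@eq_Rintegral _ _ _ _ _ (cst k)).
  by rewrite Rintegral_cst//= mu_oo.
by move=> t; rewrite inE /= in_itv /= => /fk.
Qed.

Lemma norm_oint_le f a b M : bddmeas f -> a <= b -> (forall t, `|f t| <= M) ->
  `|oint f a b| <= M * (b - a).
Proof.
move=> bf ab fM; apply: (le_trans (le_normr_Rintegral _ _)) => //.
  exact: bddmeas_integrable_oo.
rewrite -(@oint_cst (fun=> M))// /oint; apply: le_Rintegral => //.
- apply: (@bddmeas_integrable_oo (fun t => `|f t|)); split.
    by apply: measurableT_comp => //; exact: bf.1.
  by exists M => t; rewrite normr_id.
- by apply: (@bddmeas_integrable_oo (fun=> M)); split => //; exists `|M|.
Qed.

Lemma bddmeasZD (k : R) f g : bddmeas f -> bddmeas g -> bddmeas (fun t => k * f t + g t).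
Proof.
move=> [mf [M fM]] [mg [N gN]]; split.
  by apply: measurable_funD => //; exact: measurable_funM.
exists (`|k| * M + N) => t; apply: (le_trans (ler_normD _ _)).
by rewrite normrM lerD// ler_wpM2l.
Qed.

Lemma bddmeas0 : bddmeas (fun=> 0).
Proof. by split=> //; exists 0 => t; rewrite normr0. Qed.

Lemma ointZD (k : R) f g a b : bddmeas f -> bddmeas g ->
  oint (fun t => k * f t + g t) a b = k * oint f a b + oint g a b.
Proof.
move=> bf bg; rewrite /oint RintegralD//.
- by rewrite RintegralZl//; exact: bddmeas_integrable_oo.
- apply: (@bddmeas_integrable_oo (fun t => k * f t)).
  rewrite (_ : (fun t => k * f t) = fun t => k * f t + 0).
    exact: bddmeasZD bddmeas0.
  by apply/funext => t; rewrite addr0.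
- exact: bddmeas_integrable_oo.
Qed.

Lemma oint0 a b : oint (fun=> 0) a b = 0.
Proof. by rewrite /oint Rintegral_cst// mul0r. Qed.

Section LinComb.
Context (r : nat -> R -> R) (br : forall i, bddmeas (r i)).

Definition lincomb (c : nat -> R) K (t : R) : R := \sum_(i < K) c i * r i t.

Lemma lincombS c K : lincomb c K.+1 = fun t => c K * r K t + lincomb c K t.
Proof. by apply/funext => t; rewrite /lincomb big_ord_recr addrC. Qed.

Lemma lincomb0 c : lincomb c 0 = fun=> 0.
Proof. by apply/funext => t; rewrite /lincomb big_ord0. Qed.

Lemma bddmeas_lincomb c K : bddmeas (lincomb c K).
Proof.
elim: K => [|K IH]; first by rewrite lincomb0; exact: bddmeas0.
by rewrite lincombS; exact: bddmeasZD.
Qed.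

Lemma oint_lincomb c K a b : oint (lincomb c K) a b = \sum_(i < K) c i * oint (r i) a b.
Proof.
elim: K => [|K IH]; first by rewrite lincomb0 oint0 big_ord0.
rewrite lincombS ointZD ?big_ord_recr ?IH 1?addrC//.
exact: bddmeas_lincomb.
Qed.
End LinComb.

Local Notation rad := (@rademacher R).

Lemma bddmeas_rad n : bddmeas (rad n).
Proof.
split; last by exists 1 => t; rewrite /rademacher normrX normrN1 expr1n.
(* Since [(-1) ^+ k] is the cosine of [pi * k], [rad n] is a continuous function of a nondecreasing
   one. *)
have -> : rad n = cos \o ( *%R pi) \o (fun t => (Num.truncn (2 ^+ n * t))%:R).
  apply/funext => t; rewrite /rademacher /=.
  elim: (Num.truncn _) => [|k IH]; first by rewrite mulr0 cos0.
  by rewrite exprS IH -addn1 natrD mulrDr mulr1 cosDpi mulN1r.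
apply: measurableT_comp; last first.
  apply: nondecreasing_measurable => // s t st.
  by rewrite ler_nat; apply: le_truncn; rewrite ler_wpM2l// exprn_ge0.
apply: measurableT_comp; last exact: mulrl_measurable.
by apply: continuous_measurable_fun; exact: continuous_cos.
Qed.

Lemma norm_rad n t : `|rad n t| = 1.
Proof. by rewrite /rademacher normrX normrN1 expr1n. Qed.

Lemma rad_dyadic n k t : k%:R / 2 ^+ n < t < k.+1%:R / 2 ^+ n -> rad n t = (-1) ^+ k.
Proof.
have n0 : 0 < 2 ^+ n :> R by rewrite exprn_gt0.
rewrite ltr_pdivrMr// ltr_pdivlMr// mulrC => /andP[kt tk].
by rewrite /rademacher (@truncn_def _ _ k)// ltW.
Qed.

Lemma oint_rad_dyadic n k :
  oint (rad n) (k%:R / 2 ^+ n) (k.+1%:R / 2 ^+ n) = (-1) ^+ k / 2 ^+ n.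
Proof.
have n0 : 0 < 2 ^+ n :> R by rewrite exprn_gt0.
rewrite (@oint_cst _ _ _ ((-1) ^+ k)).
- by rewrite -mulrBl -natrB// subSnn mul1r.
- by rewrite ler_pM2r ?invr_gt0// ler_nat.
- by move=> t /rad_dyadic.
Qed.

(** Neighbouring dyadic intervals of level [n] cancel in pairs, so only the parity of [k]
    survives. *)
Lemma oint_rad0_dyadic n k : oint (rad n) 0 (k%:R / 2 ^+ n) = (odd k)%:R / 2 ^+ n.
Proof.
have n0 : 0 < 2 ^+ n :> R by rewrite exprn_gt0.
elim: k => [|k IH].
  by rewrite !mul0r /oint set_itvoo0 Rintegral_set0.
rewrite (@oint_split _ _ _ (k%:R / 2 ^+ n)) ?divr_ge0//; first last.
- by rewrite ler_pM2r ?invr_gt0// ler_nat.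
- exact: bddmeas_rad.
rewrite IH oint_rad_dyadic -mulrDl -signr_odd /=; congr (_ / _).
by case: odd => /=; lra.
Qed.

(** Cut at the last multiple of [1 / 2 ^+ n] not exceeding [x]: each of the two pieces contributes
    at most [1 / 2 ^+ n]. *)
Lemma norm_oint_rad0 n x : 0 <= x -> `|oint (rad n) 0 x| <= 2 / 2 ^+ n.
Proof.
have n0 : 0 < 2 ^+ n :> R by rewrite exprn_gt0.
move=> x0; set k := Num.truncn (2 ^+ n * x).
have /andP[k1 k2] : k%:R <= 2 ^+ n * x < k.+1%:R by rewrite truncn_itv// mulr_ge0// ltW.
have kx : k%:R / 2 ^+ n <= x by rewrite ler_pdivrMr// mulrC.
rewrite (@oint_split _ _ _ (k%:R / 2 ^+ n)) ?divr_ge0//; last exact: bddmeas_rad.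
rewrite oint_rad0_dyadic (le_trans (ler_normD _ _))//.
have -> : 2 / 2 ^+ n = 1 / 2 ^+ n + 1 / 2 ^+ n :> R by lra.
apply: lerD.
  rewrite normrM [X in _ * X]gtr0_norm ?invr_gt0//.
  by rewrite ler_pM2r ?invr_gt0//; case: odd; rewrite ?normr1 ?normr0.
apply: (le_trans (norm_oint_le (M := 1) (bddmeas_rad n) kx _)).
  by move=> t; rewrite norm_rad.
rewrite mul1r ler_pdivlMr// mulrBl divfK ?gt_eqF//.
by rewrite mulrC lerBlDr -(natrD _ 1%N) add1n ltW.
Qed.

Lemma norm_oint_rad n a b : 0 <= a -> a <= b -> `|oint (rad n) a b| <= 4 / 2 ^+ n.
Proof.
move=> a0 ab; have b0 := le_trans a0 ab.
have -> : oint (rad n) a b = oint (rad n) 0 b - oint (rad n) 0 a.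
  by rewrite (@oint_split _ 0 b a)// ?[_ + _ - _]addrAC ?subrr ?add0r//; exact: bddmeas_rad.
apply: (le_trans (ler_normB _ _)).
have -> : 4 / 2 ^+ n = 2 / 2 ^+ n + 2 / 2 ^+ n :> R by lra.
by apply: lerD; exact: norm_oint_rad0.
Qed.

(** The endpoints of a dyadic interval of level [m] are even multiples of [1 / 2 ^+ n], where the
    primitive of [rad n] vanishes. *)
Lemma oint_rad_coarse m n j : (m < n)%N ->
  oint (rad n) (j%:R / 2 ^+ m) (j.+1%:R / 2 ^+ m) = 0.
Proof.
move=> mn; have m0 : 0 < 2 ^+ m :> R by rewrite exprn_gt0.
have E i : i%:R / 2 ^+ m = (i * 2 ^ (n - m))%:R / 2 ^+ n :> R.
  apply/eqP; rewrite eqr_div ?expf_neq0 ?pnatr_eq0//.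
  by rewrite natrM natrX -mulrA -exprD subnK// ltnW.
have O i : odd (i * 2 ^ (n - m)) = false.
  by rewrite oddM oddX /= orbF subn_eq0 leqNgt mn andbF.
have : oint (rad n) 0 (j.+1%:R / 2 ^+ m) =
  oint (rad n) 0 (j%:R / 2 ^+ m) + oint (rad n) (j%:R / 2 ^+ m) (j.+1%:R / 2 ^+ m).
  apply: oint_split; first exact: bddmeas_rad.
    by rewrite divr_ge0// ltW.
  by rewrite ler_pM2r ?invr_gt0// ler_nat.
by rewrite !E !oint_rad0_dyadic !O !mul0r add0r => <-.
Qed.

(** On a dyadic interval of level [n_ k] the finer terms integrate to 0, the k-th one has constant
    sign, and each coarser one is bounded by its coefficient times the length. *)
Lemma oint_rad_lincomb_dyadic (n_ : nat -> nat) (c : nat -> R) K k j :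
  {homo n_ : i j / (i < j)%N} -> (k < K)%N ->
  (`|c k| - \sum_(i < k) `|c i|) / 2 ^+ n_ k <=
  `|oint (lincomb (fun i => rad (n_ i)) c K) (j%:R / 2 ^+ n_ k) (j.+1%:R / 2 ^+ n_ k)|.
Proof.
move=> hn kK; have n0 : 0 < 2 ^+ n_ k :> R by rewrite exprn_gt0.
rewrite oint_lincomb; last by move=> i; exact: bddmeas_rad.
set a := j%:R / _; set b := j.+1%:R / _.
have -> : \sum_(i < K) c i * oint (rad (n_ i)) a b =
    c k * ((-1) ^+ j / 2 ^+ n_ k) + \sum_(i < k) c i * oint (rad (n_ i)) a b.
  rewrite -(big_mkord predT (fun i => c i * oint (rad (n_ i)) a b)) /=.
  rewrite (big_cat_nat (n := k.+1))//= [X in _ + X]big_nat_cond [X in _ + X]big1 ?addr0; last first.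
    by move=> i; rewrite andbT => /andP[ki _]; rewrite oint_rad_coarse ?mulr0// hn.
  by rewrite big_nat_recr//= big_mkord oint_rad_dyadic addrC.
apply: le_trans (lerB_normD _ _).
rewrite mulrBl lerB//.
  by rewrite 2!normrM normrX normrN1 expr1n mul1r (@gtr0_norm _ (2 ^- n_ k)) ?invr_gt0.
apply: (le_trans (ler_norm_sum _ _ _)); rewrite mulr_suml; apply: ler_sum => i _.
rewrite normrM ler_wpM2l//.
have h : a <= b by rewrite ler_pM2r ?invr_gt0// ler_nat.
apply: (le_trans (norm_oint_le (M := 1) (bddmeas_rad _) h _)).
  by move=> t; rewrite norm_rad.
by rewrite -mulrBl -natrB// subSnn mul1r mul1r.
Qed.

Lemma disjoint_length_le1 m (a b : 'I_m -> R) :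
  (forall j, [&& 0 <= a j, a j < b j & b j <= 1]) ->
  trivIset [set: 'I_m] (fun j => `]a j, b j[%classic) ->
  \sum_(j < m) (b j - a j) <= 1.
Proof.
case: m a b => [a b _ _|m a b ab tab]; first by rewrite big_ord0 ler01.
have mF (j : 'I_m.+1) : measurable (`]a j, b j[%classic : set R) by exact: measurable_itv.
rewrite -lee_fin -sumEFin.
rewrite (eq_bigr (fun j : 'I_m.+1 => mu `]a j, b j[)); last first.
  by move=> j _; rewrite mu_oo//; have /and3P[_ /ltW] := ab j.
rewrite -(@measure_bigsetU_ord _ _ _ mu m.+1 predT _ mF tab).
have -> : 1%E = mu `]0, 1[ by rewrite mu_oo// subr0.
apply: le_measure; rewrite ?inE//.
  exact: bigsetU_measurable.
rewrite -bigcup_mkord_ord => t [j _] /=; rewrite !in_itv /= => /andP[ajt tbj].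
have /and3P[a0 _ b1] := ab (inord j); rewrite (le_lt_trans a0)//=.
exact: lt_le_trans b1.
Qed.

End StepIntegrals.

(** * CCP for lists *)

Lemma sum_count_mem (R : realType) (s : seq nat) K (g : nat -> R) :
  {in s, forall k, (k < K)%N} ->
  \sum_(k <- s) g k = \sum_(k < K) (count_mem (k : nat) s)%:R * g k.
Proof.
elim: s => [_|x s IH H].
  by rewrite big_nil big1// => i _; rewrite mul0r.
have xK : (x < K)%N by rewrite H// mem_head.
rewrite big_cons IH => [|k ks]; last by rewrite H// inE ks orbT.
under [RHS]eq_bigr do rewrite /= natrD mulrDl.
rewrite big_split /=; congr (_ + _).
rewrite (bigD1 (Ordinal xK))//= eqxx mul1r big1 ?addr0// => i ix.
rewrite (_ : x == i = false) ?mul0r//.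
by apply: contraNF ix => /eqP xi; apply/eqP/val_inj.
Qed.

Lemma perm_flatten_nseq (s : seq nat) K : {in s, forall k, (k < K)%N} ->
  perm_eq (flatten [seq nseq (count_mem k s) k | k <- iota 0 K]) s.
Proof.
move=> sK; apply/allP => j _ /=; apply/eqP.
rewrite count_flatten -map_comp sumnE big_map.
have [jK|Kj] := ltnP j K; last first.
  rewrite big1_seq => [|k /andP[_]].
    by apply/esym/count_memPn/negP => /sK; rewrite ltnNge Kj.
  rewrite mem_iota add0n /= => kK; rewrite count_nseq /=.
  by rewrite ltn_eqF ?mul0n// (leq_trans kK).
rewrite (bigD1_seq j) ?iota_uniq ?mem_iota//= count_nseq /= eqxx mul1n.
rewrite big1_seq ?addn0// => k /andP[kj _].
by rewrite count_nseq /= (negbTE kj) mul0n.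
Qed.

Section Lists.
Context {R : realType} {X : normedModType R} (e : nat -> X).
Context (e_sym : one_symmetric_basis e).

(** Disjointness of the blocks makes the second projection injective on the pairs [(k, i)] with
    [i \in I_ k], so the sum is a reindexed list in which [c k] occurs [size (I_ k)] times. *)
Lemma snorm_blocks (c : nat -> R) (I_ : nat -> seq nat) K :
  (forall k, (k < K)%N -> uniq (I_ k)) ->
  (forall k l i, (k < K)%N -> (l < K)%N -> i \in I_ k -> i \in I_ l -> k = l) ->
  `|\sum_(k < K) c k *: \sum_(n <- I_ k) e n| =
  snorm e (map c (flatten [seq nseq (size (I_ k)) k | k <- iota 0 K])).
Proof.
move=> uI dI; pose P := [seq (k, i) | k <- iota 0 K, i <- I_ k].
have -> : flatten [seq nseq (size (I_ k)) k | k <- iota 0 K] = map fst P.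
  rewrite map_allpairs; congr flatten; apply: eq_map => k /=.
  by elim: (I_ k) => //= x s ->.
rewrite -map_comp -(@snorm_reindex _ _ e e_sym _ P snd (c \o fst)).
  congr (`| _ |); rewrite big_allpairs_dep /=.
  rewrite -(big_mkord predT (fun k => c k *: \sum_(n <- I_ k) e n)).
  by rewrite /index_iota subn0; apply: eq_bigr => k _; rewrite scaler_sumr.
rewrite map_inj_in_uniq.
  apply: allpairs_uniq_dep; first exact: iota_uniq.
    by move=> k; rewrite mem_iota add0n => /uI.
  by move=> [k i] [l j] _ _ /= [-> ->].
move=> _ _ /allpairsPdep[k [i [+ ik ->]]] /allpairsPdep[l [j [+ jl ->]]] /= ij.
rewrite !mem_iota !add0n /= => kK lK; rewrite -{j}ij in jl *.
by rewrite (dI _ _ _ kK lK ik jl).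
Qed.

(* A finite family (I_k) is encoded by the list s in which k occurs #I_k times. *)
Definition ccp_lists (n_ : nat -> nat) (C : R) := forall s : seq nat,
  \sum_(k <- s) (2 ^+ n_ k)^-1 <= 1 :> R ->
  snorm e (map (fun k => (lambda_ e (2 ^ n_ k))^-1) s) <= C.

Lemma norm_sum_fset (A : {fset nat}) : `|\sum_(n <- A) e n| = lambda_ e #|` A|.
Proof.
have := @snorm_reindex _ _ e e_sym _ (A : seq nat) id (fun=> 1).
rewrite map_id => /(_ (fset_uniq A)).
under eq_bigr do rewrite scale1r.
by move=> ->; congr snorm; elim: (A : seq nat) => //= x s ->.
Qed.

Lemma cardfs_iota (m n : nat) : #|` [fset i in iota m n]%fset| = n.
Proof. by rewrite card_fseq undup_id ?iota_uniq ?size_iota. Qed.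

(** Only multiplicities matter: [sigma] consists of consecutive blocks of lengths [2 ^ n_ k], and
    [I_ k] is the initial piece of [sigma k] whose length is the number of occurrences of [k] in
    [s]. *)
Lemma ccp_to_lists : ccp e -> exists n_ C,
  [/\ {homo n_ : i j / (i < j)%N}, forall k, (0 < n_ k)%N, 0 < C & ccp_lists n_ C].
Proof.
move=> [n_ [C [n_homo n_pos C0 H]]]; exists n_, C; split=> // s s1.
pose K := (\max_(k <- s) k).+1.
have sK : {in s, forall k, (k < K)%N}.
  by move=> k ks; rewrite ltnS; apply: leq_bigmax_seq.
pose S k := (\sum_(l < k) 2 ^ n_ l)%N.
pose m k := count_mem k s.
pose sigma k : {fset nat} := [fset i in iota (S k) (2 ^ n_ k)]%fset.
pose I_ k : {fset nat} := [fset i in iota (S k) (m k)]%fset.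
have csig k : #|` sigma k| = (2 ^ n_ k)%N by exact: cardfs_iota.
have cI k : #|` I_ k| = m k by exact: cardfs_iota.
have mK k : (K <= k)%N -> m k = 0%N.
  by move=> Kk; apply/count_memPn/negP => /sK; rewrite ltnNge Kk.
have sE := sum_count_mem (fun k => (2 ^+ n_ k)^-1 : R) sK.
(* The weight condition on [s] is what makes [I_ k] fit into [sigma k]. *)
have m2 k : (m k <= 2 ^ n_ k)%N.
  have [kK|/mK->//] := ltnP k K.
  rewrite -(ler_nat R) natrX -[leRHS]mul1r -ler_pdivrMr ?exprn_gt0//.
  apply: le_trans s1; rewrite sE (bigD1 (Ordinal kK))//= lerDl sumr_ge0//.
have [|||cu] := H sigma csig _ I_.
- move=> k i j; rewrite !inE !mem_iota => /andP[_ iS] /andP[+ _].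
  by apply: leq_trans; rewrite /S big_ord_recr.
- move=> k; apply/fsubsetP => i; rewrite !inE !mem_iota => /andP[-> iS]/=.
  by rewrite (leq_trans iS)// leq_add2l.
- apply: lime_le; first exact: is_cvg_nneseries.
  exists K => // N /= KN; rewrite sumEFin lee_fin (le_trans _ s1)// sE.
  rewrite (big_cat_nat (n := K))//= [X in _ + X]big_nat_cond [X in _ + X]big1 ?addr0.
    rewrite big_mkord le_eqVlt; apply/orP; left; apply/eqP; apply: eq_bigr => k _.
    by rewrite cI csig natrX.
  by move=> k /andP[/andP[Kk _] _]; rewrite cI mK// mul0r.
apply: le_trans; rewrite le_eqVlt; apply/orP; left; apply/eqP.
set u := series _ in cu *.
(* No [k >= K] occurs in [s], so the series is constant from [K] on. *)
have uE N : (K <= N)%N -> u N = u K.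
  move=> KN; rewrite /u /series /= (big_cat_nat (n := K))//= [X in _ + X]big_nat_cond.
  rewrite [X in _ + X]big1 ?addr0// => k /andP[/andP[Kk _] _].
  have /eqP : #|` I_ k| = 0%N by rewrite cI mK.
  by rewrite cardfs_eq0 => /eqP ->; rewrite big_seq_fset0 scaler0.
have -> : limn u = u K.
  apply/cvg_lim => //; rewrite -(cvg_shiftn K).
  rewrite (_ : (fun n => u (n + K)%N) = fun=> u K); first exact: cvg_cst.
  by apply/funext => N; rewrite uE// leq_addl.
rewrite /u /series /= big_mkord.
under [in RHS]eq_bigr do rewrite norm_sum_fset csig.
rewrite (@snorm_blocks (fun k => (lambda_ e (2 ^ n_ k))^-1) (fun k => I_ k : seq nat)).
- apply: snorm_perm => //; apply: perm_map; rewrite perm_sym.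
  have := perm_flatten_nseq sK; congr (perm_eq (flatten _) _).
  by apply: eq_map => k; rewrite -/(m k) -cI.
- by move=> k _; exact: fset_uniq.
- move=> k l i _ _; rewrite !inE !mem_iota => /andP[ki ik] /andP[li il].
  have Smono a b : (a <= b)%N -> (S a <= S b)%N.
    by move=> /subnKC <-; rewrite /S big_split_ord leq_addr.
  have SS a : (S a + m a <= S a.+1)%N by rewrite /S big_ord_recr /= leq_add2l.
  have key a b : (S a <= i)%N -> (i < S b + m b)%N -> (a <= b)%N.
    move=> ai ib; rewrite leqNgt; apply/negP => /Smono ab.
    by have := leq_trans (leq_trans ib (SS b)) (leq_trans ab ai); rewrite ltnn.
  by apply/eqP; rewrite eqn_leq; apply/andP; split; apply: key.
Qed.

Lemma big_ord_support (V : nmodType) (F : nat -> V) a b :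
  (forall k, F k != 0 -> (k < a)%N && (k < b)%N) ->
  \sum_(k < a) F k = \sum_(k < b) F k.
Proof.
suff H c d : (c <= d)%N -> (forall k, F k != 0 -> (k < c)%N) ->
    \sum_(k < c) F k = \sum_(k < d) F k.
  move=> Fab; have [ab|/ltnW ba] := leqP a b.
    by apply: H => // k /Fab /andP[].
  by apply/esym/H => // k /Fab /andP[].
move=> /subnKC <- Fc; rewrite big_split_ord /= [X in _ + X]big1 ?addr0// => k _.
by apply/eqP; apply: contraT => /Fc; rewrite ltnNge leq_addr.
Qed.

Context (refl : reflexive_space X).

(** The list bound controls all partial sums of the block series. These form a subsequence of the
    partial sums of one basis expansion, so bounded completeness gives convergence. *)
Lemma lists_to_ccp n_ C : {homo n_ : i j / (i < j)%N} -> (forall k, (0 < n_ k)%N) ->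
  0 < C -> ccp_lists n_ C -> ccp e.
Proof.
move=> n_homo n_pos C0 H; exists n_, C; split=> // sigma csig succ lambda I_ Isub Isum u.
pose lam k : R := (lambda_ e (2 ^ n_ k))^-1.
have uE N : u N = \sum_(k < N) lam k *: \sum_(n <- I_ k) e n.
  rewrite /u /series /= big_mkord; apply: eq_bigr => k _.
  by rewrite /lambda norm_sum_fset csig.
have sub k i : i \in I_ k -> i \in sigma k by move/fsubsetP: (Isub k); apply.
have sig_ex k : exists i, i \in sigma k.
  by apply/fset0Pn; rewrite -cardfs_gt0 csig expn_gt0.
have succ_lt k l i j : (k < l)%N -> i \in sigma k -> j \in sigma l -> (i < j)%N.
  elim: l j => // l IH j; rewrite ltnS leq_eqVlt => /predU1P[->|kl] ik jl.
    exact: succ ik jl.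
  by have [x xl] := sig_ex l; apply: (ltn_trans (IH _ kl ik xl)); exact: succ jl.
have label_uniq k l i : i \in I_ k -> i \in I_ l -> k = l.
  move=> /sub ik /sub il; case: (ltngtP k l) => // kl.
    by have := succ_lt _ _ _ _ kl ik il; rewrite ltnn.
  by have := succ_lt _ _ _ _ kl il ik; rewrite ltnn.
have sigma_ge k i : i \in sigma k -> (k <= i)%N.
  elim: k i => // k IH i ik; have [x xk] := sig_ex k.
  by apply: leq_ltn_trans (IH _ xk) _; exact: succ ik.
have u_le N : `|u N| <= C.
  rewrite uE (@snorm_blocks lam (fun k => I_ k : seq nat)).
  - apply: H; rewrite big_flatten big_map -{1}(subn0 N) -/(index_iota 0 N) -lee_fin.
    apply: le_trans Isum.
    rewrite (_ : (_ %:E) = \sum_(0 <= k < N) (#|` I_ k|%:R / #|` sigma k|%:R)%:E)%E.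
      exact: nneseries_lim_ge.
    rewrite sumEFin; congr (_ %:E); apply: eq_bigr => k _.
    by rewrite big_nseq iter_addr_0 csig natrX mulr_natl.
  - by move=> k _; exact: fset_uniq.
  - by move=> k l i _ _; exact: label_uniq.
(* [psi N] is the first index after the blocks [sigma 0], ..., [sigma N.-1]. *)
pose psi N := if N is N'.+1 then (\max_(i <- sigma N') i).+1 else 0%N.
have psiP k i N : i \in sigma k -> (k < N)%N = (i < psi N)%N.
  move=> ik; case: N => //= N; rewrite !ltnS; apply/idP/idP => kN.
    have [<-|kN'] := eqVneq k N; first exact: leq_bigmax_seq.
    have [x xN] := sig_ex N; apply: (@leq_trans x); last exact: leq_bigmax_seq.
    by apply/ltnW/(succ_lt k N) => //; rewrite ltn_neqAle kN'.
  rewrite leqNgt; apply/negP => Nk.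
  have [x xN] := sig_ex N; have i0 := leq_trans (ltn0Sn _) (succ_lt _ _ _ _ Nk xN ik).
  have : (\max_(j <- sigma N) j <= i.-1)%N.
    apply/bigmax_leqP_seq => j jN _; rewrite -ltnS prednK//.
    exact: succ_lt Nk jN ik.
  by rewrite leqNgt prednK// kN.
(* The coefficient of [e i] in the block series; blocks [k > i] cannot contain [i], by
   [sigma_ge]. *)
pose c i : R := \sum_(k < i.+1) (i \in I_ k)%:R * lam k.
have uc N : u N = series (fun i => c i *: e i) (psi N).
  rewrite uE /series /= big_mkord.
  transitivity (\sum_(k < N) \sum_(i < psi N) ((i : nat) \in I_ k)%:R *: (lam k *: e i)).
    apply: eq_bigr => k _.
    rewrite -(big_mkord predT (fun i => (i \in I_ k)%:R *: (lam k *: e i))) /index_iota subn0.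
    rewrite [RHS](bigID (fun i => i \in I_ k)) /= [X in _ = _ + X]big1 ?addr0; last first.
      by move=> i /negbTE ik; rewrite ik scale0r.
    rewrite -[RHS](big_filter _ (fun i => i \in I_ k)) scaler_sumr.
    rewrite [RHS](perm_big (I_ k : seq nat)) /=; last first.
      apply: uniq_perm; [by rewrite filter_uniq ?iota_uniq|exact: fset_uniq|].
      move=> i; rewrite mem_filter mem_iota add0n /=; case: (boolP (i \in I_ k)) => //= ik.
      by rewrite -(psiP _ _ _ (sub _ _ ik)) ltn_ord.
    by apply/esym/eq_big_seq => i ik; rewrite ik scale1r.
  rewrite exchange_big /=; apply: eq_bigr => i _.
  under eq_bigr do rewrite scalerA.
  rewrite -scaler_suml; congr (_ *: _).
  apply: (@big_ord_support _ (fun k => ((i : nat) \in I_ k)%:R * lam k)) => k.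
  case: (boolP (_ \in I_ k)) => [ik _|_]; last by rewrite mul0r eqxx.
  by rewrite (psiP _ _ _ (sub _ _ ik)) ltn_ord ltnS sigma_ge// sub.
have psi_ge N : (N <= psi N)%N.
  case: N => //= N; have [x xN] := sig_ex N.
  by rewrite ltnS (leq_trans (sigma_ge _ _ xN))// leq_bigmax_seq.
(* Partial sums have nondecreasing norms, so the bound at the indices [psi n], which are at least
   [n], holds at all indices. *)
have /cvg_ex[/= x cx] : cvgn (series (fun i => c i *: e i)).
  apply: (@boundedly_complete _ _ e e_sym refl c C) => n.
  by apply: le_trans (u_le n); rewrite uc norm_psum_mono.
have ux : u @ \oo --> x.
  rewrite (_ : u = series (fun i => c i *: e i) \o psi); last exact/funext.
  apply: cvg_comp cx => A [N _ NA]; exists N => // n /= Nn.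
  by apply: NA => /=; exact: leq_trans (psi_ge n).
split; first by apply/cvg_ex; exists x.
rewrite -lim_norm; last by apply/cvg_ex; exists x.
apply: limr_le; last by near=> n; exact: u_le.
by apply: is_cvg_norm; apply/cvg_ex; exists x.
Unshelve. all: by end_near. Qed.
End Lists.

(** * Lacunary subsequences and geometric sums *)

Section Sparse.
Context {R : realType}.
Implicit Types u v : nat -> R.

(** For the positive sequences to which it is applied, this is convergence to 0. *)
Definition eventually_small u := forall eps, 0 < eps ->
  exists N, forall n, (N <= n)%N -> u n < eps.

Lemma eventually_small_subseq u (psi : nat -> nat) :
  {homo psi : i j / (i < j)%N} -> eventually_small u -> eventually_small (u \o psi).
Proof.
move=> psih us eps /us[N uN]; exists N => n Nn; apply: uN.
rewrite (leq_trans Nn)//; elim: n {Nn} => // n IH.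
exact: leq_ltn_trans IH (psih _ _ _).
Qed.

Lemma sparse_subseq u v : (forall n, 0 < u n) -> (forall n, 0 < v n) ->
  eventually_small u -> eventually_small v ->
  exists psi : nat -> nat, [/\ {homo psi : i j / (i < j)%N},
    forall k, u (psi k.+1) <= u (psi k) / 4 & forall k, v (psi k.+1) <= v (psi k) / 4].
Proof.
move=> u0 v0 us vs.
have next n : exists m, [/\ (n < m)%N, u m <= u n / 4 & v m <= v n / 4].
  have [N uN] := us (u n / 4) (divr_gt0 (u0 n) (ltr0n _ 4)).
  have [M vM] := vs (v n / 4) (divr_gt0 (v0 n) (ltr0n _ 4)).
  exists (n.+1 + N + M)%N; split; first by rewrite -addnA leq_addr.
    by apply/ltW/uN; rewrite addnAC leq_addl.
  by apply/ltW/vM; rewrite leq_addl.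
have [g gP] := choice next.
exists (fun k => iter k g 0%N); split=> [|k|k]; last 2 first.
- by have [] := gP (iter k g 0%N).
- by have [] := gP (iter k g 0%N).
by apply: homo_ltn => [? ? ?|k]; [exact: ltn_trans|have [] := gP (iter k g 0%N)].
Qed.

Lemma geometric_tail u k K : (forall i, 0 <= u i) ->
  (forall i, u i.+1 <= u i / 4) -> \sum_(k <= i < K) u i <= 2 * u k.
Proof.
move=> u0 u4; have [kK|Kk] := leqP k K; last by rewrite big_geq ?mulr_ge0// ltnW.
(* A telescoping form that is stable under induction, as [u i <= (4 / 3) * (u i - u i.+1)]. *)
suff : \sum_(k <= i < K) u i <= (4 / 3) * (u k - u K).
  by have := u0 k; have := u0 K; lra.
rewrite -(subnKC kK); elim: (K - k)%N => [|n IH]; first by rewrite addn0 big_geq// subrr mulr0.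
rewrite addnS big_nat_recr ?leq_addr//=.
by have := u4 (k + n)%N; lra.
Qed.

Lemma geometric_head u k : (forall i, 0 <= u i) ->
  (forall i, 4 * u i <= u i.+1) -> \sum_(i < k) u i <= u k / 2.
Proof.
move=> u0 u4; elim: k => [|k IH]; first by rewrite big_ord0 divr_ge0.
by rewrite big_ord_recr /=; have := u4 k; have := u0 k; lra.
Qed.

Lemma sum_uniq_le u (s : seq nat) : uniq s -> (forall i, 0 <= u i) ->
  exists K, \sum_(k <- s) u k <= \sum_(0 <= k < K) u k.
Proof.
move=> us u0; exists (\max_(k <- s) k).+1.
rewrite (@sum_count_mem _ _ (\max_(k <- s) k).+1 u); last first.
  by move=> k ks; rewrite ltnS; apply: leq_bigmax_seq.
rewrite big_mkord; apply: ler_sum => k _; rewrite count_uniq_mem//.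
by case: (_ \in _); rewrite ?mul1r ?mul0r.
Qed.

End Sparse.

(** * The JF norm computed through families of disjoint intervals *)

Section SnormMore.
Context {R : realType} {X : normedModType R} (e : nat -> X).
Context (e_sym : one_symmetric_basis e).

Lemma snorm_le_sum s : snorm e s <= (\sum_(x <- s) `|x|) * `|e 0%N|.
Proof.
elim: s => [|x s IH]; first by rewrite snorm_nil big_nil mul0r.
rewrite -cat1s (le_trans (snorm_cat e_sym _ _))// big_cons mulrDl lerD//.
by rewrite snorm1.
Qed.

Lemma snormD (T : Type) (s : seq T) (c d : T -> R) :
  snorm e [seq c x + d x | x <- s] <= snorm e (map c s) + snorm e (map d s).
Proof.
case: s => [|x0 s']; first by rewrite snorm_nil addr0.
set s := x0 :: s'.
rewrite /snorm !size_map; apply: le_trans (ler_normD _ _).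
rewrite -big_split le_eqVlt; apply/orP; left; apply/eqP; congr (`| _ |).
by apply: eq_bigr => i _; rewrite !(nth_map x0) ?ltn_ord// scalerDl.
Qed.

Lemma snorm_filter (T : Type) (s : seq T) (P : pred T) (c : T -> R) :
  snorm e [seq (if P x then c x else 0) | x <- s] = snorm e (map c [seq x <- s | P x]).
Proof.
suff H u : snorm e (u ++ [seq (if P x then c x else 0) | x <- s]) =
  snorm e (u ++ map c [seq x <- s | P x]) by exact: (H [::]).
elim: s u => //= x s IH u; case: ifP => _ /=.
  by rewrite -!cat_rcons IH.
rewrite -[RHS]IH -[RHS]snorm_cons0//; apply: snorm_perm => //.
by rewrite perm_sym perm_cons_cat.
Qed.

Lemma lambda_gt0 m : (0 < m)%N -> 0 < lambda_ e m.
Proof.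
by move=> m0; rewrite (lt_le_trans _ (lambda_mono e_sym m0))// lambda1 norm_basis_gt0.
Qed.

Lemma lambda_pow_gt0 n : 0 < lambda_ e (2 ^ n).
Proof. by rewrite lambda_gt0// expn_gt0. Qed.

Lemma sum_enum_ord m (c : 'I_m -> R) :
  `|\sum_(j < m) c j *: e j| = snorm e (map c (enum 'I_m)).
Proof.
rewrite -(@snorm_reindex _ _ e e_sym _ _ val); first by rewrite big_enum.
by rewrite val_enum_ord iota_uniq.
Qed.

Definition disjoint_family m (a b : 'I_m -> R) :=
  (forall j, [&& 0 <= a j, a j < b j & b j <= 1]) /\
  trivIset [set: 'I_m] (fun j => [set` `]a j, b j[ ]).

Lemma JF_norm_le (f : R -> R) B :
  (forall m (a b : 'I_m -> R), disjoint_family a b ->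
    snorm e [seq oint f (a j) (b j) | j <- enum 'I_m] <= B) ->
  JF_norm e f <= B.
Proof.
move=> H; apply: ge_sup.
  exists `|\sum_(j < 0) (0 : R) *: e j|, 0%N, (fun=> 0), (fun=> 1).
  by split=> [[]//|[]//|]; rewrite !big_ord0.
move=> _ [m [a [b [ab tab ->]]]].
by rewrite (sum_enum_ord (fun j => oint f (a j) (b j))); exact: H.
Qed.

Lemma JF_norm_ge (f : R -> R) m (a b : 'I_m -> R) : bddmeas f -> disjoint_family a b ->
  snorm e [seq oint f (a j) (b j) | j <- enum 'I_m] <= JF_norm e f.
Proof.
move=> bf [ab tab]; rewrite -(sum_enum_ord (fun j => oint f (a j) (b j))).
apply: ub_le_sup; last by exists m, a, b; split.
(* For the [sup] to dominate its elements the set must be bounded; here [M] times the total length,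
   at most 1, does it. *)
have [_ [M fM]] := bf.
exists (M * `|e 0%N|) => _ [{}m [{}a [{}b [{}ab {}tab ->]]]].
rewrite (sum_enum_ord (fun j => oint f (a j) (b j))).
apply: (le_trans (snorm_le_sum _)); rewrite ler_wpM2r// big_map big_enum /=.
have M0 : 0 <= M by rewrite (le_trans _ (fM 0)).
apply: (@le_trans _ _ (\sum_(j < m) M * (b j - a j))).
  apply: ler_sum => j _; apply: norm_oint_le => //.
  by have /and3P[_ /ltW] := ab j.
by rewrite -mulr_sumr -[leRHS]mulr1 ler_wpM2l// disjoint_length_le1.
Qed.

(** The source of all lower bounds: intervals of lengths [1 / 2 ^+ n_ k], for [k] in [s], are packed
    side by side into (0,1), and on each of them [oint_rad_lincomb_dyadic] applies. *)
Lemma JF_norm_test (n_ : nat -> nat) (c d : nat -> R) K (s : seq nat) :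
  {homo n_ : i j / (i < j)%N} -> {in s, forall k, (k < K)%N} ->
  \sum_(k <- s) (2 ^+ n_ k)^-1 <= 1 :> R ->
  {in s, forall k, 0 <= d k <= `|c k| - \sum_(i < k) `|c i|} ->
  snorm e [seq d k / 2 ^+ n_ k | k <- s] <=
  JF_norm e (lincomb (fun i => rademacher (n_ i)) c K).
Proof.
(* Longest intervals first, so that the packed intervals are dyadic. *)
move=> n_homo; wlog ss : s / sorted leq s => [H sK s1 sd|].
  have ps : perm_eq (sort leq s) s by exact/permPl/perm_sort.
  rewrite -(snorm_perm e_sym (perm_map _ ps)); apply: H.
  - exact: sort_sorted leq_total _.
  - by move=> k; rewrite mem_sort; exact: sK.
  - by rewrite (perm_big _ ps).
  - by move=> k; rewrite mem_sort; exact: sd.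
move=> sK s1 sd; set m := size s.
pose n i := n_ (nth 0%N s i).
pose A j : R := \sum_(i < j) (2 ^+ n i)^-1.
have pos i : 0 < (2 ^+ n i)^-1 :> R by rewrite invr_gt0 exprn_gt0.
have AS j : A j.+1 = A j + (2 ^+ n j)^-1 by rewrite /A big_ord_recr.
have Amono i j : (i <= j)%N -> A i <= A j.
  by move=> /subnKC <-; rewrite /A big_split_ord /= lerDl sumr_ge0// => k _; exact: ltW.
have A0 j : 0 <= A j by rewrite sumr_ge0// => k _; exact: ltW.
have A1 : A m <= 1.
  by rewrite (le_trans _ s1)// (big_nth 0%N) big_mkord.
have nmono i j : (i <= j)%N -> (j < m)%N -> (n i <= n j)%N.
  move=> ij jm; have im := leq_ltn_trans ij jm.
  have : (nth 0%N s i <= nth 0%N s j)%N.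
    by apply: (sorted_leq_nth leq_trans leqnn 0%N ss); rewrite ?inE.
  by rewrite leq_eqVlt => /predU1P[|/n_homo/ltnW//]; rewrite /n => ->.
(* The earlier intervals are at least as long as the j-th one, so their lengths are integer
   multiples of its length. *)
have Adyadic j : (j < m)%N -> exists p : nat, A j = p%:R / 2 ^+ n j.
  move=> jm; exists (\sum_(i < j) 2 ^ (n j - n i))%N.
  rewrite /A natr_sum mulr_suml; apply: eq_bigr => i _.
  rewrite natrX; have ij := nmono _ _ (ltnW (ltn_ord i)) jm.
  by rewrite -[in X in _ / X](subnK ij) exprD invfM mulrA mulfV ?mul1r// expf_neq0.
pose a (j : 'I_m) := A j; pose b (j : 'I_m) := A j.+1.
have bf : bddmeas (lincomb (fun i => rademacher (n_ i)) c K).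
  by apply: bddmeas_lincomb => i; exact: bddmeas_rad.
have dab : disjoint_family a b.
  split=> [j|].
    by rewrite A0 /= /a /b AS ltrDl pos/= -AS (le_trans _ A1)// Amono.
  apply/trivIsetP => i j _ _ ij; apply/seteqP; split=> // t [] /=.
  rewrite !in_itv /= => /andP[it ti] /andP[jt tj].
  have [lij|lji|/val_inj eij] := ltngtP i j; last by rewrite eij eqxx in ij.
    by have := lt_le_trans ti (Amono _ _ lij); rewrite ltNge (ltW jt).
  by have := lt_le_trans tj (Amono _ _ lji); rewrite ltNge (ltW it).
apply: le_trans (JF_norm_ge bf dab).
have -> : [seq d k / 2 ^+ n_ k | k <- s] =
    [seq d (nth 0%N s j) / 2 ^+ n j | j : 'I_m <- enum 'I_m].
  rewrite -{1}(mkseq_nth 0%N s) /mkseq -/m -val_enum_ord -!map_comp.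
  by [].
apply: snorm_mono => // j _.
have jm := ltn_ord j; have js := mem_nth 0%N jm.
have /andP[d0 dle] := sd _ js; have [p Ap] := Adyadic _ jm.
rewrite ger0_norm ?divr_ge0// ?exprn_ge0//.
have -> : b j = p.+1%:R / 2 ^+ n j by rewrite /b AS Ap -(natr1 p) mulrDl mul1r.
rewrite /a Ap; apply: le_trans (oint_rad_lincomb_dyadic _ _ n_homo (sK _ js)).
by rewrite ler_pM2r.
Qed.

End SnormMore.

(** * Estimates for the JF norm of lacunary Rademacher sums *)

Section Estimates.
Context {R : realType} {X : normedModType R} (e : nat -> X).
Context (e_sym : one_symmetric_basis e).

(** The levels [n + i] merely provide a strictly increasing sequence starting at [n], as
    [JF_norm_test] requires. *)
Lemma lincomb_rad1 n : lincomb (fun i => @rademacher R (n + i)) (fun=> 1) 1 = rademacher n.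
Proof. by apply/funext => t; rewrite /lincomb big_ord1 addn0 mul1r. Qed.

(** Test on all [2 ^ n] dyadic intervals of level [n]. *)
Lemma JF_norm_rad_ge n : lambda_ e (2 ^ n) / 2 ^+ n <= JF_norm e (@rademacher R n).
Proof.
have <- : snorm e [seq 1 / 2 ^+ (n + k) | k <- nseq (2 ^ n) 0%N] = lambda_ e (2 ^ n) / 2 ^+ n.
  by rewrite map_nseq snorm_nseq// addn0 ger0_norm ?divr_ge0 ?exprn_ge0// mul1r mulrC.
rewrite -lincomb_rad1.
apply: (@JF_norm_test _ _ e e_sym (fun i => n + i)%N (fun=> 1) (fun=> 1)).
- by move=> i j; rewrite ltn_add2l.
- by move=> k /nseqP[->].
- by rewrite big_nseq iter_addr_0 addn0 -[_ *+ (2 ^ n)]mulr_natl natrX mulfV// expf_neq0.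
- by move=> k /nseqP[-> _]; rewrite big_ord0 subr0 normr1 ler01 lexx.
Qed.

(** Each integral is at most [4 / 2 ^+ n] in absolute value and their absolute values sum to at most
    1. After rounding, at most [2 ^ n] entries equal [4 / 2 ^+ n], plus one leftover; both parts
    cost at most [4 * (lambda_ e (2 ^ n) / 2 ^+ n)]. *)
Lemma JF_norm_rad_le n : JF_norm e (@rademacher R n) <= 8 * (lambda_ e (2 ^ n) / 2 ^+ n).
Proof.
have n0 : 0 < 2 ^+ n :> R by rewrite exprn_gt0.
apply: JF_norm_le => // m a b [ab tab].
set c := fun j => oint _ _ _; set s := enum _.
pose w j := `|c j| / (4 / 2 ^+ n).
have z0 : 0 < 4 / 2 ^+ n :> R by rewrite divr_gt0.
have w01 j : 0 <= w j <= 1.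
  rewrite divr_ge0 ?(ltW z0)//= ler_pdivrMr// mul1r.
  by have /and3P[a0 /ltW lab _] := ab j; exact: norm_oint_rad.
have sw : \sum_(j <- s) w j <= 2 ^+ n.
  rewrite -mulr_suml ler_pdivrMr// mulrCA mulfV ?gt_eqF// mulr1.
  apply: (@le_trans _ _ 1); last by rewrite (ler_nat _ 1 4).
  apply: le_trans (disjoint_length_le1 ab tab); rewrite big_enum /=.
  apply: ler_sum => j _; have /and3P[a0 /ltW lab _] := ab j.
  rewrite -[leRHS]mul1r; apply: norm_oint_le => //; first exact: bddmeas_rad.
  by move=> t; rewrite norm_rad.
(* All weights get the same label 0, so at most one leftover remains. *)
have [p /mapP[j _ ->]|s1 [s2 [us2 ss2 w2 gE le]]] :=
  @snorm_rounding _ _ e e_sym (fun=> 4 / 2 ^+ n) [seq (0%N, w j) | j <- s].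
  exact: w01.
have s1n : (size s1 <= 2 ^ n)%N.
  rewrite -(ler_nat R) natrX; apply: le_trans sw.
  have := gE (fun=> 1); rewrite big_map /=.
  under [in RHS]eq_bigr do rewrite mul1r.
  move=> <-; rewrite (_ : \sum_(k <- s1) _ = (size s1)%:R); last first.
    by rewrite big_const_seq count_predT iter_addr_0.
  rewrite lerDl big_seq sumr_ge0// => p /w2 /andP[p0 _].
  by rewrite mul1r.
have l0 : 0 < lambda_ e (2 ^ n) by exact: lambda_pow_gt0.
have s2n : snorm e [seq 4 / 2 ^+ n * p.2 | p <- s2] <= 4 / 2 ^+ n * lambda_ e (2 ^ n).
  have : (size s2 <= 1)%N.
    rewrite -(size_map fst) (uniq_leq_size us2 (s2 := [:: 0%N]))// => k /ss2.
    by rewrite -map_comp => /mapP[j _ ->]; rewrite inE.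
  case: s2 w2 {us2 ss2 gE le} => [|p [|//]] w2 _ /=.
    by rewrite snorm_nil// mulr_ge0// ltW.
  have /andP[p0 p1] : 0 <= p.2 <= 1 by rewrite w2// mem_head.
  rewrite snorm1 ger0_norm ?mulr_ge0 ?(ltW z0)//.
  apply: ler_pM; rewrite ?mulr_ge0 ?(ltW z0)//.
    by rewrite -[leRHS]mulr1 ler_wpM2l ?(ltW z0).
  by rewrite -lambda1 (lambda_mono e_sym)// expn_gt0.
have := le [::]; rewrite /= -map_comp /=.
have -> : snorm e [seq ((fun p => 4 / 2 ^+ n * p.2) \o (fun j => (0%N, w j))) j | j <- s] =
   snorm e (map c s).
  apply/eqP; rewrite eq_le; apply/andP; split; apply: snorm_mono => // j _ /=.
    by rewrite mulrC divfK ?gt_eqF// normr_id.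
  by rewrite mulrC divfK ?gt_eqF// normr_id.
move=> /le_trans; apply; apply: (le_trans (snorm_cat e_sym _ _)).
have -> : map (fun=> 4 / 2 ^+ n) s1 = nseq (size s1) (4 / 2 ^+ n) :> seq R.
  by elim: (s1) => //= ? ? ->.
rewrite snorm_nseq (ger0_norm (ltW z0)).
have := ler_wpM2l (ltW z0) (lambda_mono e_sym s1n).
have : 4 / 2 ^+ n * lambda_ e (2 ^ n) = 4 * (lambda_ e (2 ^ n) / 2 ^+ n) by lra.
by move: s2n; lra.
Qed.

Section Upper.
(** In the application [theta k] is the inverse norm of the Rademacher function of level [n_ k], and
    [c i] is [theta i] times a scalar bounded by [M]. *)
Context (n_ : nat -> nat) (theta c : nat -> R) (C M : R) (K : nat).
Let lam k := (lambda_ e (2 ^ n_ k))^-1.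
Let f := lincomb (fun i => rademacher (n_ i)) c K.
Context (theta_ge0 : forall k, 0 <= theta k)
  (theta_le : forall k, theta k <= 2 ^+ n_ k * lam k)
  (theta4 : forall k, 4 * theta k <= theta k.+1)
  (lam4 : forall k, lam k.+1 <= lam k / 4)
  (M0 : 0 <= M) (cM : forall i, (i < K)%N -> `|c i| <= M * theta i).

Lemma lam_ge0 k : 0 <= lam k.
Proof. by rewrite invr_ge0 lambda_ge0. Qed.

(* k is the number of i < K with 2^-n_i >= b - a. *)
Lemma oint_lincomb_scale (a b : R) : 0 <= a -> a < b -> exists k,
  [/\ (0 < k)%N -> 2 ^+ n_ k.-1 * (b - a) <= 1,
      (k < K)%N -> (2 ^+ n_ k)^-1 <= b - a &
      `|oint f a b| <= M * (2 * (if (0 < k)%N then lam k.-1 * (2 ^+ n_ k.-1 * (b - a)) else 0)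
                        + 8 * (if (k < K)%N then lam k else 0))].
Proof.
move=> a0 ab; have l0 : 0 <= b - a by rewrite subr_ge0 ltW.
have p0 i : 0 < 2 ^+ n_ i :> R by rewrite exprn_gt0.
pose p i := (2 ^+ n_ i)^-1 < b - a.
pose k := find p (iota 0 K).
have kK : (k <= K)%N by rewrite -[leqRHS](size_iota 0) find_size.
have below i : (i < k)%N -> b - a <= (2 ^+ n_ i)^-1.
  move=> ik; have := before_find 0%N ik.
  by rewrite nth_iota ?(leq_trans ik)// add0n /p leNgt => ->.
exists k; split=> [k0|kK'|].
- rewrite mulrC -ler_pdivlMr// mul1r; apply: below.
  by rewrite prednK.
- apply/ltW; have hp : has p (iota 0 K) by rewrite has_find size_iota.
  by have := nth_find 0%N hp; rewrite -/k nth_iota.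
rewrite oint_lincomb; last by move=> i; exact: bddmeas_rad.
rewrite -(big_mkord predT (fun i => c i * oint (rademacher (n_ i)) a b)) /=.
rewrite (big_cat_nat (n := k))//= (le_trans (ler_normD _ _))// mulrDr lerD//.
(* Coarse levels [i < k]: each integral is at most the length, and the [theta i] sum to at most
   twice the last one. *)
- apply: (le_trans (ler_norm_sum _ _ _)).
  apply: (@le_trans _ _ (\sum_(0 <= i < k) M * (b - a) * theta i)).
    rewrite big_nat [leRHS]big_nat; apply: ler_sum => i /andP[_ ik].
    rewrite normrM mulrAC ler_pM// ?cM ?(leq_trans ik)//.
    rewrite -[leRHS]mul1r; apply: norm_oint_le; [exact: bddmeas_rad|exact: ltW|].
    by move=> t; rewrite norm_rad.
  rewrite -mulr_sumr -mulrA ler_wpM2l// big_mkord.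
  case: (k) => [|j] /=; first by rewrite big_ord0 !mulr0.
  have := geometric_head j theta_ge0 theta4; have := theta_ge0 j; have := theta_le j.
  rewrite big_ord_recr /= => h1 h2 h3.
  have h : \sum_(i < j) theta i + theta j <= 2 * (2 ^+ n_ j * lam j) by lra.
  by have := ler_wpM2l l0 h; lra.
(* Fine levels [i >= k]: an integral is at most [4 / 2 ^+ n_ i], which leaves [4 * M * lam i], a
   geometric tail. *)
- apply: (le_trans (ler_norm_sum _ _ _)).
  case: ifPn => [kK'|]; last by rewrite -leqNgt => Kk; rewrite big_geq// !mulr0.
  apply: (@le_trans _ _ (\sum_(k <= i < K) 4 * M * lam i)).
    rewrite big_nat [leRHS]big_nat; apply: ler_sum => i /andP[_ iK].
    rewrite normrM; apply: (@le_trans _ _ (M * (2 ^+ n_ i * lam i) * (4 / 2 ^+ n_ i))).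
      apply: ler_pM => //; last by apply: norm_oint_rad => //; exact: ltW.
      by apply: (le_trans (cM iK)); rewrite ler_wpM2l.
    rewrite le_eqVlt; apply/orP; left; apply/eqP.
    have := mulfV (lt0r_neq0 (p0 i)).
    move: (2 ^+ n_ i) (2 ^- n_ i) (lam i) => x y z xy.
    rewrite (_ : _ * _ = 4 * M * z * (x * y)); last by lra.
    by rewrite xy mulr1.
  rewrite -mulr_sumr; have := geometric_tail k K lam_ge0 lam4.
  move=> h; have := ler_wpM2l M0 h; lra.
Qed.

(** By [oint_lincomb_scale] the integrals are dominated by [M * (2 * v1 j + 8 * v2 j)]; the two
    lists are estimated separately. *)
Lemma JF_norm_lincomb_le : ccp_lists e n_ C ->
  JF_norm e f <= M * (2 * (C + 2 * lam 0%N * `|e 0%N|) + 8 * C).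
Proof.
move=> ccpC; apply: JF_norm_le => // m a b [ab tab].
have sl := disjoint_length_le1 ab tab.
have /choice[k kP] : forall j : 'I_m, exists k,
  [/\ (0 < k)%N -> 2 ^+ n_ k.-1 * (b j - a j) <= 1,
      (k < K)%N -> (2 ^+ n_ k)^-1 <= b j - a j &
      `|oint f (a j) (b j)| <=
        M * (2 * (if (0 < k)%N then lam k.-1 * (2 ^+ n_ k.-1 * (b j - a j)) else 0)
          + 8 * (if (k < K)%N then lam k else 0))].
  by move=> j; have /and3P[a0 lab _] := ab j; exact: oint_lincomb_scale.
pose w j := 2 ^+ n_ (k j).-1 * (b j - a j).
pose v1 j := if (0 < k j)%N then lam (k j).-1 * w j else 0.
pose v2 j := if (k j < K)%N then lam (k j) else 0.
have l0 j : 0 <= b j - a j.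
  by have /and3P[_ lab _] := ab j; rewrite subr_ge0 ltW.
have w0 j : 0 <= w j by rewrite mulr_ge0// exprn_ge0.
set s := enum _.
apply: (@le_trans _ _ (snorm e (map ( *%R M) [seq 2 * v1 j + 8 * v2 j | j <- s]))).
  rewrite -(map_comp ( *%R M)); apply: snorm_mono => // j _ /=.
  have [_ _ h] := kP j; apply: (le_trans h).
  by rewrite ler_norm.
rewrite snorm_scale// ger0_norm// ler_wpM2l//.
apply: (le_trans (snormD e s (fun j => 2 * v1 j) (fun j => 8 * v2 j))).
rewrite (map_comp ( *%R 2) v1) (map_comp ( *%R 8) v2) !snorm_scale// !ger0_norm//.
have sle (P : pred 'I_m) : \sum_(j <- s | P j) (b j - a j) <= 1.
  apply: le_trans sl; rewrite big_enum_cond /= [leRHS](bigID P) /= lerDl.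
  by rewrite sumr_ge0.
apply: lerD; rewrite ler_wpM2l//; last first.
  (* The intervals concerned have length at least [1 / 2 ^+ n_ (k j)] and total length at most 1, so
     the list of the [k j] is admissible for CCP. *)
  rewrite (@snorm_filter _ _ e e_sym _ s (fun j => (k j < K)%N) (fun j => lam (k j))).
  rewrite (map_comp lam k); apply: ccpC.
  rewrite big_map big_filter; apply: le_trans (sle _); apply: ler_sum => j kK.
  by have [_ /(_ kK)] := kP j.
rewrite (@snorm_filter _ _ e e_sym _ s (fun j => (0 < k j)%N) (fun j => lam (k j).-1 * w j)).
(* Rounding preserves sums weighted by any function of the label; with the weights [1 / 2 ^+ n_ i]
   this sum is a total length, so [s1] is admissible for CCP. *)
set s' := [seq _ <- s | _].
have [p /mapP[j +]|s1 [s2 [us2 ss2 w2 gE le]]] :=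
  @snorm_rounding _ _ e e_sym lam [seq ((k j).-1, w j) | j <- s'].
  rewrite mem_filter => /andP[k0 _] -> /=; rewrite w0 /=.
  by have [/(_ k0)] := kP j.
have := le [::]; rewrite /= -map_comp /= => /le_trans; apply.
apply: (le_trans (snorm_cat e_sym _ _)); apply: lerD.
  apply: ccpC; have := gE (fun i => (2 ^+ n_ i)^-1).
  rewrite big_map /= => h.
  apply: (@le_trans _ _ (\sum_(j <- s') 2 ^- n_ (k j).-1 * w j)).
    rewrite -h lerDl big_seq sumr_ge0// => p /w2/andP[p0 _].
    by rewrite mulr_ge0// invr_ge0 exprn_ge0.
  rewrite big_filter; apply: le_trans (sle (fun j => (0 < k j)%N)); apply: ler_sum => j _.
  by rewrite /w mulrA mulVf ?mul1r// expf_neq0.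
(* The leftovers have distinct labels, so the geometric decay of [lam] bounds them in l^1. *)
apply: (le_trans (snorm_le_sum e_sym _)); rewrite ler_wpM2r//.
have [L Lle] := sum_uniq_le us2 lam_ge0.
apply: le_trans (geometric_tail 0 L lam_ge0 lam4); apply: le_trans Lle.
rewrite !big_map big_seq [leRHS]big_seq; apply: ler_sum => p /w2/andP[p0 p1].
by rewrite ger0_norm ?mulr_ge0 ?lam_ge0// -[leRHS]mulr1 ler_wpM2l ?lam_ge0.
Qed.

End Upper.

Context (refl : reflexive_space X).

Lemma lambda_pow_small : eventually_small (fun n => (lambda_ e (2 ^ n))^-1).
Proof.
move=> eps eps0; have [m mP] := lambda_unbounded e_sym refl eps^-1.
exists m => n mn; rewrite -(invrK eps) ltf_pV2 ?posrE ?invr_gt0 ?(lambda_pow_gt0 e_sym)//.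
apply: (lt_le_trans mP); apply: lambda_mono => //.
by rewrite (leq_trans mn)// ltnW// ltn_expl.
Qed.

Lemma JF_norm_rad_small : eventually_small (fun n => JF_norm e (@rademacher R n)).
Proof.
move=> eps eps0; have [m mP] := lambda_sublinear e_sym refl (divr_gt0 eps0 (ltr0n _ 8)).
exists m => n mn; apply: (le_lt_trans (JF_norm_rad_le n)).
(* By subadditivity of [lambda_] the quotients do not increase, so one small value suffices. *)
have q k : lambda_ e (2 ^ (m + k)) / 2 ^+ (m + k) <= lambda_ e (2 ^ m) / 2 ^+ m.
  elim: k => [|k IH]; first by rewrite addn0.
  apply: le_trans IH; rewrite addnS exprS invfM mulrA ler_wpM2r ?invr_ge0 ?exprn_ge0//.
  rewrite ler_pdivrMr// mulr_natr mulr2n.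
  by apply: le_trans (lambdaD e_sym _ _); rewrite expnS mul2n addnn.
have := q (n - m)%N; rewrite subnKC// => h.
have : lambda_ e (2 ^ m) / 2 ^+ m < eps / 8 by rewrite ltr_pdivrMr ?exprn_gt0.
by lra.
Qed.

End Estimates.

(** * The equivalence of CCP with a c_0 subsequence *)

Section Main.
Context {R : realType} {X : completeNormedModType R} (e : nat -> X).
Context {J : completeNormedModType R} (iota : (R -> R) -> J).
Context (refl : reflexive_space X) (e_sym : one_symmetric_basis e) (jf : is_JF e iota).

Let rho n : R := `|iota (rademacher n)|.

Lemma norm_iota f : bddmeas f -> `|iota f| = JF_norm e f.
Proof. by move=> /bddmeas_L1; have [_ h _] := jf; exact: h. Qed.

Lemma iota_lincomb (r : nat -> R -> R) (c : nat -> R) K : (forall i, bddmeas (r i)) ->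
  iota (lincomb r c K) = \sum_(i < K) c i *: iota (r i).
Proof.
move=> br; have [lin _ _] := jf; elim: K => [|K IH]; last first.
  rewrite lincombS lin; [|exact/bddmeas_L1|exact/bddmeas_L1/bddmeas_lincomb].
  by rewrite IH big_ord_recr addrC.
have L0 : L1 (fun=> 0 : R) by exact/bddmeas_L1/bddmeas0.
(* [iota] of the zero function equals its own double, hence is 0. *)
rewrite lincomb0 big_ord0; have := lin 1 _ _ L0 L0.
rewrite scale1r (_ : (fun t => 1 * 0 + 0) = fun=> 0 : R); last first.
  by apply/funext => t; rewrite mulr0 addr0.
by move=> /esym/eqP; rewrite -subr_eq0 addrK => /eqP.
Qed.

Lemma rho_ge n : lambda_ e (2 ^ n) / 2 ^+ n <= rho n.
Proof. by rewrite /rho norm_iota ?JF_norm_rad_ge//; exact: bddmeas_rad. Qed.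

Lemma rho_le n : rho n <= 8 * (lambda_ e (2 ^ n) / 2 ^+ n).
Proof. by rewrite /rho norm_iota ?JF_norm_rad_le//; exact: bddmeas_rad. Qed.

Lemma rho_gt0 n : 0 < rho n.
Proof.
by apply: lt_le_trans (rho_ge n); rewrite divr_gt0 ?exprn_gt0//; exact: lambda_pow_gt0.
Qed.

Lemma rho_small : eventually_small rho.
Proof.
move=> eps /(JF_norm_rad_small e_sym refl)[N NP]; exists N => n /NP.
by rewrite /rho norm_iota//; exact: bddmeas_rad.
Qed.

Lemma norm_iota_comb (n_ : nat -> nat) (a : nat -> R) K :
  `|\sum_(i < K) a i *: ((rho (n_ i))^-1 *: iota (rademacher (n_ i)))| =
  JF_norm e (lincomb (fun i => rademacher (n_ i)) (fun i => a i / rho (n_ i)) K).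
Proof.
have br i : bddmeas (rademacher (n_ i) : R -> R) by exact: bddmeas_rad.
rewrite -norm_iota; last exact: bddmeas_lincomb.
by rewrite iota_lincomb//; congr (`| _ |); apply: eq_bigr => i _; rewrite scalerA.
Qed.

(** By reflexivity [rho n] and the inverse of [lambda_ e (2 ^ n)] both tend to 0, so one subsequence
    is lacunary for both. *)
Lemma sparse_levels (n_ : nat -> nat) : {homo n_ : i j / (i < j)%N} ->
  exists psi : nat -> nat, [/\ {homo psi : i j / (i < j)%N},
    forall k, 4 * (rho (n_ (psi k)))^-1 <= (rho (n_ (psi k.+1)))^-1 &
    forall k, (lambda_ e (2 ^ n_ (psi k.+1)))^-1 <= (lambda_ e (2 ^ n_ (psi k)))^-1 / 4].
Proof.
move=> hn; have [||||psi [hpsi rpsi lpsi]] := @sparse_subseq R (rho \o n_)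
    ((fun n => (lambda_ e (2 ^ n))^-1) \o n_).
- by move=> n; exact: rho_gt0.
- by move=> n; rewrite invr_gt0; exact: lambda_pow_gt0.
- exact: eventually_small_subseq rho_small.
- by apply: eventually_small_subseq => //; exact: lambda_pow_small.
exists psi; split=> // k; have /= h := rpsi k.
rewrite -[4]invrK -invfM lef_pV2 ?posrE ?mulr_gt0 ?invr_gt0 ?rho_gt0// mulrC.
exact: h.
Qed.

Lemma inv_rho_bounds n : (2 ^+ n * (lambda_ e (2 ^ n))^-1) / 8 <= (rho n)^-1
  <= 2 ^+ n * (lambda_ e (2 ^ n))^-1.
Proof.
have l0 : 0 < lambda_ e (2 ^ n) by exact: lambda_pow_gt0.
have p0 : 0 < 2 ^+ n :> R by rewrite exprn_gt0.
have E : 2 ^+ n * (lambda_ e (2 ^ n))^-1 = (lambda_ e (2 ^ n) / 2 ^+ n)^-1.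
  by rewrite invf_div mulrC.
rewrite E -invfM !lef_pV2 ?posrE ?rho_gt0 ?mulr_gt0 ?divr_gt0 ?invr_gt0//.
by rewrite rho_ge mulrC rho_le.
Qed.

Section SparseLevels.
Context (n_ : nat -> nat) (hn : {homo n_ : i j / (i < j)%N}).
Let theta k := (rho (n_ k))^-1.
Let lam k := (lambda_ e (2 ^ n_ k))^-1.
Context (theta4 : forall k, 4 * theta k <= theta k.+1).
Context (lam4 : forall k, lam k.+1 <= lam k / 4).

Let theta_gt0 k : 0 < theta k. Proof. by rewrite invr_gt0 rho_gt0. Qed.

Let norm_theta k : `|(rho (n_ k))^-1| = theta k.
Proof. by rewrite gtr0_norm// invr_gt0 rho_gt0. Qed.

(** At the levels in [s] the coefficient has maximal size [A], so the coarser terms absorb at most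
    half of the main term [A * theta k]. With [theta k >= 2 ^+ n_ k * lam k / 8] this gives the
    factor 16. *)
Lemma sparse_lower (a : nat -> R) K (s : seq nat) (A : R) : 0 <= A ->
  {in s, forall k, (k < K)%N} -> \sum_(k <- s) (2 ^+ n_ k)^-1 <= 1 :> R ->
  {in s, forall k, `|a k| = A} -> (forall k, (k < K)%N -> `|a k| <= A) ->
  A * snorm e (map lam s) <=
  16 * `|\sum_(i < K) a i *: ((rho (n_ i))^-1 *: iota (rademacher (n_ i)))|.
Proof.
move=> A0 sK s1 sa aA; rewrite norm_iota_comb.
have h := @JF_norm_test _ _ e e_sym n_ (fun i => a i / rho (n_ i)) (fun k => A * theta k / 2)
  K s hn sK s1.
have /h {}h : {in s, forall k, 0 <= A * theta k / 2 <=
    `|a k / rho (n_ k)| - \sum_(i < k) `|a i / rho (n_ i)|}.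
  move=> k ks; rewrite divr_ge0 ?mulr_ge0 ?(ltW (theta_gt0 k))//=.
  rewrite normrM sa// norm_theta.
  have : \sum_(i < k) `|a i / rho (n_ i)| <= A * (theta k / 2).
    apply: (@le_trans _ _ (\sum_(i < k) A * theta i)).
      apply: ler_sum => i _; rewrite normrM norm_theta.
      by rewrite ler_wpM2r ?(ltW (theta_gt0 _))// aA// (ltn_trans (ltn_ord i))// sK.
    by rewrite -mulr_sumr ler_wpM2l// geometric_head// => i; exact: ltW.
  by rewrite /theta; lra.
rewrite -ler_pdivrMl//; apply: le_trans h.
have -> : 16^-1 * (A * snorm e (map lam s)) = snorm e (map ( *%R (16^-1 * A)) (map lam s)).
  by rewrite snorm_scale// ger0_norm ?mulr_ge0// mulrA.
rewrite -(map_comp ( *%R _)); apply: snorm_mono => // k _ /=.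
have /andP[t1 _] := inv_rho_bounds (n_ k).
have l0 : 0 <= lam k by rewrite invr_ge0 lambda_ge0.
have p0 : 0 < 2 ^+ n_ k :> R by rewrite exprn_gt0.
rewrite !ger0_norm ?(divr_ge0, mulr_ge0) ?(ltW p0, lambda_ge0, ltW (rho_gt0 _))//.
rewrite ler_pdivlMr//.
have := ler_wpM2l A0 t1; rewrite -/(theta k) -/(lam k); lra.
Qed.

Lemma sparse_ccp_lists C :
  (forall K, `|\sum_(i < K) (rho (n_ i))^-1 *: iota (rademacher (n_ i))| <= C) ->
  ccp_lists e n_ (16 * C).
Proof.
move=> HC s s1; pose K := (\max_(k <- s) k).+1.
have sK : {in s, forall k, (k < K)%N}.
  by move=> k ks; rewrite ltnS; apply: leq_bigmax_seq.
have := @sparse_lower (fun=> 1) K s 1 ler01 sK s1.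
rewrite mul1r normr1 => h; apply: (le_trans (h _ _)) => //.
rewrite ler_wpM2l//; apply: le_trans (HC K).
by under eq_bigr do rewrite scale1r.
Qed.

Lemma max_norm_attained (a : nat -> R) K : (0 < K)%N ->
  exists2 k, (k < K)%N & forall i, (i < K)%N -> `|a i| <= `|a k|.
Proof.
case: K => // K _; elim: K => [|K [k kK kmax]].
  by exists 0%N => // -[].
have [ak|ak] := leP `|a K.+1| `|a k|.
  exists k => [|i]; first exact: ltnW.
  by rewrite ltnS leq_eqVlt => /predU1P[->//|]; exact: kmax.
exists K.+1 => // i; rewrite ltnS leq_eqVlt => /predU1P[->//|/kmax/le_trans]; apply.
exact: ltW.
Qed.

Lemma sparse_equivalent_c0 C : 0 < C -> ccp_lists e n_ C ->
  equivalent_c0 (fun k => (rho (n_ k))^-1 *: iota (rademacher (n_ k))).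
Proof.
(* The constant of [JF_norm_lincomb_le], to be applied with the largest [|a i|] as [M]. *)
move=> C0 ccpC; pose B := 2 * (C + 2 * lam 0%N * `|e 0%N|) + 8 * C.
have l0 : 0 <= lam 0%N by rewrite invr_ge0 lambda_ge0.
have B0 : 0 < B by have := mulr_ge0 l0 (normr_ge0 (e 0%N)); rewrite /B; lra.
exists 16^-1, B; split=> // K a; set A := \big[Num.max/0]_(i < K) `|a i|.
have A0 : 0 <= A.
  by rewrite /A; elim/big_ind: _ => // x y x0 y0; rewrite le_max x0.
have aA i : (i < K)%N -> `|a i| <= A.
  by move=> iK; exact: (le_bigmax _ (fun i : 'I_K => `|a i|) (Ordinal iK)).
apply/andP; split; last first.
  rewrite norm_iota_comb mulrC.
  apply: (@JF_norm_lincomb_le _ _ e e_sym n_ theta) => //.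
  - by move=> k; exact: ltW.
  - by move=> k; have /andP[] := inv_rho_bounds (n_ k).
  - move=> i iK; rewrite normrM norm_theta.
    by rewrite ler_wpM2r ?aA// (ltW (theta_gt0 _)).
rewrite ler_pdivrMl//.
have [K0|K0] := posnP K.
  by rewrite /A K0 !big_ord0 normr0 mulr0.
have [k kK kmax] := max_norm_attained a K0.
have -> : A = `|a k|.
  apply/eqP; rewrite eq_le aA// andbT.
  by apply/bigmax_leP; split=> // i _; exact: kmax.
(* The lower bound is tested on all dyadic intervals of the level [n_ k] where the maximum is
   attained; the resulting list has norm [lam k * lambda_ e (2 ^ n_ k)], which is 1. *)
have sk : {in nseq (2 ^ n_ k) k, forall j, (j < K)%N} by move=> j /nseqP[->].
have := @sparse_lower a K _ `|a k| (normr_ge0 _) sk.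
have -> : snorm e (map lam (nseq (2 ^ n_ k) k)) = 1.
  rewrite map_nseq snorm_nseq// ger0_norm// ?invr_ge0 ?lambda_ge0// mulVf//.
  by rewrite gt_eqF// lambda_pow_gt0.
rewrite mulr1.
apply=> //; last by move=> j /nseqP[->].
rewrite big_nseq iter_addr_0 -[_ *+ (2 ^ n_ k)]mulr_natl natrX mulfV// ?expf_neq0//.
Qed.

End SparseLevels.

Lemma ccp_lists_subseq n_ psi C : ccp_lists e n_ C -> ccp_lists e (n_ \o psi) C.
Proof.
move=> H s s1; have := H (map psi s).
by rewrite big_map -map_comp; exact.
Qed.

Lemma equivalent_c0_partial_sums (x : nat -> J) (psi : nat -> nat) :
  {homo psi : i j / (i < j)%N} -> equivalent_c0 x ->
  exists2 C, 0 < C & forall K, `|\sum_(k < K) x (psi k)| <= C.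
Proof.
move=> hpsi [c [C [_ C0 H]]]; exists C => // K.
have psi_inj : injective psi.
  move=> i j ij; case: (ltngtP i j) => // /hpsi; rewrite ij ltnn //.
(* The sum is a combination of the [x i] with coefficients 0 and 1, to which the upper c_0 estimate
   applies. *)
pose a i : R := (i \in [seq psi k | k <- seq.iota 0 K])%:R.
have /andP[_] := H (psi K) a.
have -> : \sum_(i < psi K) a i *: x i = \sum_(k < K) x (psi k).
  rewrite -(big_mkord predT (fun i => a i *: x i)) -(big_mkord predT (fun k => x (psi k))).
  rewrite /index_iota !subn0 -(big_map psi predT x) /=.
  rewrite (bigID (fun i => i \in [seq psi k | k <- seq.iota 0 K])) /=.
  rewrite [X in _ + X]big1 ?addr0; last first.
    by move=> i /negbTE ik; rewrite /a ik scale0r.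
  rewrite -big_filter; rewrite (perm_big [seq psi k | k <- seq.iota 0 K]) /=.
    by apply: eq_big_seq => i ik; rewrite /a ik scale1r.
  apply: uniq_perm; rewrite ?filter_uniq ?map_inj_uniq ?iota_uniq// => i.
  rewrite mem_filter mem_iota add0n; apply/andP/idP => [[]//|ik]; split=> //=.
  by have /mapP[k + ->] := ik; rewrite mem_iota add0n => /hpsi.
move=> /le_trans; apply; rewrite -[leRHS]mulr1 ler_wpM2l ?(ltW C0)//.
apply/bigmax_leP; split=> // i _; rewrite /a; case: (_ \in _) => //=.
  by rewrite normr1.
by rewrite normr0.
Qed.

End Main.
Unset Implicit Arguments.

Theorem theoremD (R : realType) (X : completeNormedModType R) (e : nat -> X)
    (J : completeNormedModType R) (iota : (R -> R) -> J)
    (X_reflexive : reflexive_space X)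
    (e_symmetric : one_symmetric_basis e)
    (J_completion : is_JF e iota) :
  ccp e <->
  exists phi : nat -> nat,
    {homo phi : i j / (i < j)%N} /\
    equivalent_c0 (fun k =>
      `|iota (rademacher (phi k).+1)|^-1 *: iota (rademacher (phi k).+1)).
Proof.
split=> [/(ccp_to_lists e_symmetric)[n_ [C [hn n_pos C0 ccpC]]]|[phi [hphi c0phi]]].
  have [psi [hpsi theta4 lam4]] := sparse_levels X_reflexive e_symmetric J_completion hn.
  (* The sequence in the theorem starts at level 1, hence the shift; the levels of CCP are
     positive. *)
  have pos k : (n_ (psi k)).-1.+1 = n_ (psi k) by rewrite prednK.
  exists (fun k => (n_ (psi k)).-1); split.
    by move=> i j ij; rewrite -ltnS !pos; exact/hn/hpsi.
  under eq_fun do rewrite pos.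
  apply: (sparse_equivalent_c0 e_symmetric J_completion (n_ := n_ \o psi)) C0 _ => //.
    by move=> i j /hpsi/hn.
  exact: ccp_lists_subseq.
pose n_ k := (phi k).+1.
have hn : {homo n_ : i j / (i < j)%N} by move=> i j /hphi.
have [psi [hpsi theta4 lam4]] := sparse_levels X_reflexive e_symmetric J_completion hn.
have [C C0 HC] := equivalent_c0_partial_sums hpsi c0phi.
have hnpsi : {homo n_ \o psi : i j / (i < j)%N} by move=> i j /hpsi/hn.
(* CCP holds along the sparse levels, since bounded sums of normalized Rademacher functions give the
   list bound. *)
apply: (lists_to_ccp e_symmetric X_reflexive hnpsi (fun _ => isT) (mulr_gt0 (ltr0n R 16) C0)).
by apply: (sparse_ccp_lists e_symmetric J_completion (n_ := n_ \o psi)).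
Qed.
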